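(* Let $\eta$ be an indecomposable endomorphism of a finite-dimensional vector space $U$ over $\mathbf k$ with no eigenvalue in $\mathbf k$, and let $\mathcal S_\eta$ be the associated indecomposable sextuple. The following are equivalent: 1. $\mathcal S_\eta$ is self-dual; 2. $\mathcal S_\eta$ admits compatible symplectic forms; 3. $\mathcal S_\eta$ admits compatible symmetric forms. Moreover, let $q(x)^m$ be the characteristic polynomial of $\eta$, with $q(x)$ irreducible and $\deg q(x)=l$. If $\mathcal S_\eta$ is self-dual, then compatible $\varepsilon$-symmetric forms (for $\varepsilon=1$ as well as $\varepsilon=-1$) can be given, with respect to suitable bases, by matrices of the form $$H_M=\begin{pmatrix}0&0&-M\\0&M&0\\-M&0&0\end{pmatrix},$$ where $M\in\mathbf k^{ml\times ml}$ has $l\times l$-blocks $M_{ij}$ $(1\le i,j\le m)$ with $M_{ij}=(-1)^{j+1}T$ if $i+j=m+1$ and $M_{ij}=0$ otherwise, for some $T\in\mathbf k^{l\times l}$; here $\varepsilon(H_M)=\varepsilon(M)=(-1)^{m+1}\varepsilon(T)$. Suitable bases are frame bases $\{\bar u,\bar v,\bar w\}$ such that, with respect to $\bar v=(v_1,\dots,v_{ml})$, $\eta$ has the matrix $(\tfrac12I_l+\tilde Z)I+N^l$ with $\tilde Z\in\mathbf k^{l\times l}$ a Frobenius matrix; and $T$ can be chosen to be an invertible matrix with $T\tilde ZT^{-1}=-\tilde Z^t$ which is symmetric or, alternatively, skew-symmetric.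
   Context: Standing assumptions: $\mathbf k$ is a perfect field with $\operatorname{char}\mathbf k\neq 2$; all vector spaces are finite-dimensional over $\mathbf k$. A sextuple $(V;C_i,I_i)$ in $V$ consists of subspaces $I_i\subseteq C_i\subseteq V$, $i=1,2,3$. Isomorphisms are linear bijections $f:V\to V'$ with $f(I_i)=I_i'$, $f(C_i)=C_i'$. The dual of $(V;C_i,I_i)$ is the sextuple in $V^*$ with $C_i$-members $I_i^\circ$ and $I_i$-members $C_i^\circ$ ($^\circ$ = annihilator); a sextuple is self-dual if isomorphic to its dual. A compatible $\varepsilon$-symmetric form ($\varepsilon=1$: symmetric; $\varepsilon=-1$: antisymmetric = symplectic) is a non-degenerate $\varepsilon$-symmetric bilinear form on $V$ such that $C_i=I_i^\perp$ for $i=1,2,3$. For a (skew-)symmetric matrix $X$, $\varepsilon(X)=1$ if $X$ is symmetric and $-1$ if skew-symmetric. An endomorphism $(U,\eta)$ is indecomposable if $U\neq0$ and $U$ is not a direct sum of two nonzero $\eta$-invariant subspaces. For $(U,\eta)$, the sextuple $\mathcal S_\eta$ is, in $V=U\times U\times U$: $I_1=U\times0\times0$, $I_2=0\times0\times U$, $I_3=\{(-\eta x,x,-x)\mid x\in U\}$, $C_1=U\times U\times0$, $C_2=0\times U\times U$, $C_3=\{(x,-x,0)\mid x\in U\}+I_3$. A frame basis of $\mathcal S_\eta$ is a basis $\bar u,\bar v,\bar w$ of $V$ with $u_i=(x_i,0,0)$, $v_i=(0,x_i,0)$, $w_i=(0,0,x_i)$ for a basis $(x_i)$ of $U$; the matrix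 of $\eta$ with respect to $\bar v$ is that with respect to $(x_i)$. For $Z\in\mathbf k^{l\times l}$, $ZI\in\mathbf k^{ml\times ml}$ is the block diagonal matrix with all $m$ diagonal blocks equal to $Z$; $N$ is the $ml\times ml$ matrix with $1$ on the first upper off-diagonal and $0$ elsewhere, so $N^l$ has identity blocks $I_l$ on the first upper block off-diagonal and zero blocks elsewhere. A Frobenius matrix is the companion matrix of a monic polynomial $x^l+a_{l-1}x^{l-1}+\dots+a_0$: ones on the first lower off-diagonal, last column $(-a_0,\dots,-a_{l-1})^t$, zeros elsewhere. *)

(* Defs.v *)
From HB Require Import structures.
From mathcomp Require Import all_boot all_order all_algebra all_field.
From mathcomp Require Import sesquilinear.

Set Implicit Arguments.
Unset Strict Implicit.
Unset Printing Implicit Defensive.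

Import GRing.Theory passmx.
Local Open Scope ring_scope.

Definition perfect_field (k : fieldType) : Prop :=
  forall p : {poly k}, irreducible_poly p -> separable_poly p.

Section Endomorphisms.
Variables (k : fieldType) (U : vectType k).
Implicit Types (eta : 'End(U)) (W : {vspace U}).

Definition indecomposable_endo eta : Prop :=
  {:U}%VS <> 0%VS /\
  forall W1 W2,
    (eta @: W1 <= W1)%VS -> (eta @: W2 <= W2)%VS ->
    (W1 + W2)%VS = {:U}%VS -> (W1 :&: W2)%VS = 0%VS ->
    W1 = 0%VS \/ W2 = 0%VS.

Definition char_poly_lfun eta : {poly k} :=
  char_poly (mxof (vbasis {:U}) (vbasis {:U}) eta).

(* Column convention: the j-th column of A holds the coordinates of the image
   of x_j; the library's mxof is the transpose. *)
Definition is_matrix_of n (x : n.-tuple U) eta (A : 'M[k]_n) : Prop :=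
  forall j : 'I_n, eta x`_j = \sum_(i < n) A i j *: x`_i.

End Endomorphisms.

Section Annihilator.
Variables (k : fieldType) (V : vectType k).

Definition dual_space : vectType k := 'Hom(V, k^o).

Definition eval_at (v : V) (f : 'Hom(V, k^o)) : k^o := f v.

Lemma eval_at_linear v : linear (eval_at v).
Proof. by move=> a f g; rewrite /eval_at add_lfunE scale_lfunE. Qed.

HB.instance Definition _ v :=
  GRing.isSemilinear.Build k 'Hom(V, k^o) k^o *:%R (eval_at v)
    (GRing.semilinear_linear (eval_at_linear v)).

Definition annihilator (W : {vspace V}) : {vspace dual_space} :=
  (\bigcap_(i < \dim W) lker (linfun (eval_at (vbasis W)`_i)))%VS.

Lemma mem_annihilatorP (W : {vspace V}) (f : 'Hom(V, k^o)) :
  reflect {in W, forall w, f w = 0} (f \in annihilator W).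
Proof.
apply: (iffP idP) => [/subv_bigcapP fW w wW | fW].
  rewrite (coord_vbasis wW) linear_sum big1 // => i _.
  have := fW i isT; rewrite -memvE memv_ker lfunE /= /eval_at => /eqP fi0.
  by rewrite linearZ /= fi0 scaler0.
apply/subv_bigcapP => i _; rewrite -memvE memv_ker lfunE /= /eval_at.
by rewrite fW // vbasis_mem // mem_nth // size_tuple.
Qed.

Lemma annihilatorS (W1 W2 : {vspace V}) :
  (W1 <= W2)%VS -> (annihilator W2 <= annihilator W1)%VS.
Proof.
move=> /subvP sW; apply/subvP => f /mem_annihilatorP f0.
by apply/mem_annihilatorP => w /sW /f0.
Qed.

End Annihilator.

Record sextuple (k : fieldType) (V : vectType k) := Sextuple {
  sext_C : 'I_3 -> {vspace V};
  sext_I : 'I_3 -> {vspace V};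
  sext_IC : forall i, (sext_I i <= sext_C i)%VS
}.

Section SextupleTheory.
Variable k : fieldType.

Definition sext_iso (V V' : vectType k) (S : sextuple V) (S' : sextuple V')
    : Prop :=
  exists f : 'Hom(V, V'),
    [/\ bijective f,
        forall i, (f @: sext_I S i)%VS = sext_I S' i
      & forall i, (f @: sext_C S i)%VS = sext_C S' i].

Definition dual_sextuple (V : vectType k) (S : sextuple V)
    : sextuple (dual_space V) :=
  @Sextuple k (dual_space V)
    (fun i => annihilator (sext_I S i))
    (fun i => annihilator (sext_C S i))
    (fun i => annihilatorS (sext_IC S i)).

Definition self_dual (V : vectType k) (S : sextuple V) : Prop :=
  sext_iso S (dual_sextuple S).

(* As in {hermitian _ for eps & _}, a flag eps : bool stands for the sign
   (-1) ^+ eps: false is symmetric, true is skew-symmetric. Products of signs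
   are then exclusive ors of flags. *)
Definition compatible_form (V : vectType k) (S : sextuple V) (eps : bool)
    (B : {hermitian V for eps & idfun}) : Prop :=
  nondegenerate B /\ forall i, sext_C S i = orthov B (sext_I S i).

Definition admits_compatible_form (V : vectType k) (S : sextuple V)
    (eps : bool) : Prop :=
  exists B : {hermitian V for eps & idfun}, compatible_form S B.

Definition is_gram_matrix (V : vectType k) (eps : bool)
    (B : {hermitian V for eps & idfun}) n (b : n.-tuple V) (H : 'M[k]_n)
    : Prop :=
  forall i j : 'I_n, B b`_i b`_j = H i j.

End SextupleTheory.

Section SextupleOfEndomorphism.
Variables (k : fieldType) (U : vectType k).

Definition triple_fun (a b c : 'End(U)) (x : U) : U * U * U :=
  (a x, b x, c x).

Lemma triple_fun_linear a b c : linear (triple_fun a b c).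
Proof. by move=> t x y; rewrite /triple_fun !linearP. Qed.

HB.instance Definition _ a b c :=
  GRing.isSemilinear.Build k U (U * U * U)%type *:%R (triple_fun a b c)
    (GRing.semilinear_linear (triple_fun_linear a b c)).

Definition triple_img (a b c : 'End(U)) : {vspace U * U * U} :=
  limg (linfun (triple_fun a b c)).

Lemma mem_triple_imgP (a b c : 'End(U)) v :
  reflect (exists x, v = (a x, b x, c x)) (v \in triple_img a b c).
Proof.
apply: (iffP memv_imgP) => [[x _ ->]|[x ->]].
  by exists x; rewrite lfunE.
by exists x; rewrite ?memvf // lfunE.
Qed.

Definition axis1 : {vspace U * U * U} := triple_img \1%VF 0 0.
Definition axis2 : {vspace U * U * U} := triple_img 0 \1%VF 0.
Definition axis3 : {vspace U * U * U} := triple_img 0 0 \1%VF.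
Definition antidiag12 : {vspace U * U * U} := triple_img \1%VF (- \1%VF) 0.

Variable eta : 'End(U).

Definition eta_graph : {vspace U * U * U} :=
  triple_img (- eta) \1%VF (- \1%VF).

Definition seta_C (i : 'I_3) : {vspace U * U * U} :=
  tnth [tuple (axis1 + axis2)%VS; (axis2 + axis3)%VS;
              (antidiag12 + eta_graph)%VS] i.
Definition seta_I (i : 'I_3) : {vspace U * U * U} :=
  tnth [tuple axis1; axis3; eta_graph] i.

Lemma seta_IC i : (seta_I i <= seta_C i)%VS.
Proof.
by case: i => [[|[|[|//]]] lt_i3];
  rewrite /seta_I /seta_C !(tnth_nth 0%VS) /= ?addvSl ?addvSr.
Qed.

Definition sextuple_of : sextuple (U * U * U)%type :=
  @Sextuple k (U * U * U)%type seta_C seta_I seta_IC.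

Let o0 : 'I_3 := @Ordinal 3 0 isT.
Let o1 : 'I_3 := @Ordinal 3 1 isT.
Let o2 : 'I_3 := @Ordinal 3 2 isT.

Lemma mem_I1 v :
  reflect (exists x, v = (x, 0, 0)) (v \in sext_I sextuple_of o0).
Proof.
rewrite /= /seta_I (tnth_nth 0%VS) /=; apply: (iffP (mem_triple_imgP _ _ _ _)).
  by case=> x ->; exists x; rewrite !lfunE.
by case=> x ->; exists x; rewrite !lfunE.
Qed.

Lemma mem_I2 v :
  reflect (exists x, v = (0, 0, x)) (v \in sext_I sextuple_of o1).
Proof.
rewrite /= /seta_I (tnth_nth 0%VS) /=; apply: (iffP (mem_triple_imgP _ _ _ _)).
  by case=> x ->; exists x; rewrite !lfunE.
by case=> x ->; exists x; rewrite !lfunE.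
Qed.

Lemma mem_I3 v :
  reflect (exists x, v = (- eta x, x, - x)) (v \in sext_I sextuple_of o2).
Proof.
rewrite /= /seta_I (tnth_nth 0%VS) /=; apply: (iffP (mem_triple_imgP _ _ _ _)).
  by case=> x ->; exists x; rewrite !opp_lfunE !lfunE.
by case=> x ->; exists x; rewrite !opp_lfunE !lfunE.
Qed.

Lemma mem_C1 v :
  reflect (exists x y, v = (x, y, 0)) (v \in sext_C sextuple_of o0).
Proof.
rewrite /= /seta_C (tnth_nth 0%VS) /=; apply: (iffP memv_addP).
  case=> _ /mem_triple_imgP[x ->] [_ /mem_triple_imgP[y ->] ->].
  by exists x, y; rewrite !lfunE /=; congr (_, _, _); rewrite /= ?addr0 ?add0r.
case=> x [y ->]; exists (x, 0, 0).
  by apply/mem_triple_imgP; exists x; rewrite !lfunE.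
exists (0, y, 0); last by congr (_, _, _); rewrite /= ?addr0 ?add0r.
by apply/mem_triple_imgP; exists y; rewrite !lfunE.
Qed.

Lemma mem_C2 v :
  reflect (exists x y, v = (0, x, y)) (v \in sext_C sextuple_of o1).
Proof.
rewrite /= /seta_C (tnth_nth 0%VS) /=; apply: (iffP memv_addP).
  case=> _ /mem_triple_imgP[x ->] [_ /mem_triple_imgP[y ->] ->].
  by exists x, y; rewrite !lfunE /=; congr (_, _, _); rewrite /= ?addr0 ?add0r.
case=> x [y ->]; exists (0, x, 0).
  by apply/mem_triple_imgP; exists x; rewrite !lfunE.
exists (0, 0, y); last by congr (_, _, _); rewrite /= ?addr0 ?add0r.
by apply/mem_triple_imgP; exists y; rewrite !lfunE.
Qed.

Lemma mem_C3 v :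
  reflect (exists x y, v = (x, - x, 0) + (- eta y, y, - y))
          (v \in sext_C sextuple_of o2).
Proof.
rewrite /= /seta_C (tnth_nth 0%VS) /=; apply: (iffP memv_addP).
  case=> _ /mem_triple_imgP[x ->] [_ /mem_triple_imgP[y ->] ->].
  by exists x, y; rewrite !opp_lfunE !lfunE.
case=> x [y ->]; exists (x, - x, 0).
  by apply/mem_triple_imgP; exists x; rewrite !opp_lfunE !lfunE.
exists (- eta y, y, - y) => //.
by apply/mem_triple_imgP; exists y; rewrite !opp_lfunE !lfunE.
Qed.

(* u_1, ..., u_n, v_1, ..., v_n, w_1, ..., w_n *)
Definition frame n (x : n.-tuple U) : (n + (n + n)).-tuple (U * U * U)%type :=
  [tuple of [seq (a, 0, 0) | a <- x] ++
            ([seq (0, a, 0) | a <- x] ++ [seq (0, 0, a) | a <- x])].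

End SextupleOfEndomorphism.

(* Square matrices of size ml are indexed by 'I_(\sum_(i < m) l), so that the
   block operators of the library apply. *)
Section Matrices.
Variable k : fieldType.

Definition upper_shift n : 'M[k]_n :=
  \matrix_(i < n, j < n) (j == i.+1 :> nat)%:R.

Definition frobenius_mx l (p : {poly k}) : 'M[k]_l :=
  \matrix_(i < l, j < l)
    if j.+1 == l :> nat then - p`_i else (i == j.+1 :> nat)%:R.

Definition is_frobenius l (Z : 'M[k]_l) : Prop :=
  exists p : {poly k}, [/\ p \is monic, size p = l.+1 & Z = frobenius_mx l p].

Definition jordan_mx m l (Z : 'M[k]_l) : 'M[k]_(\sum_(i < m) l) :=
  \mxdiag_(i < m) Z + upper_shift (\sum_(i < m) l) ^+ l.

(* With indices from 0, block (i, j) is on the antidiagonal iff i + j + 1 = m,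
   and the sign (-1)^(j+1) of 1-based indexing becomes (-1) ^+ j. *)
Definition M_mx m l (T : 'M[k]_l) : 'M[k]_(\sum_(i < m) l) :=
  \mxblock_(i < m, j < m) if (i + j).+1 == m then (-1) ^+ j *: T else 0.

Definition H_mx n (M : 'M[k]_n) : 'M[k]_(n + (n + n)) :=
  block_mx 0              (row_mx 0 (- M))
           (col_mx 0 (- M)) (block_mx M 0
                                      0 0).

Definition suitable_basis (U : vectType k) (eta : 'End(U)) m l
    (x : (\sum_(i < m) l).-tuple U) (Z : 'M[k]_l) : Prop :=
  [/\ basis_of {:U} x, is_frobenius Z
    & is_matrix_of x eta (jordan_mx m ((2%:R^-1)%:M + Z))].

Definition admissible_T l (Z : 'M[k]_l) (tau : bool) (T : 'M[k]_l) : Prop :=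
  [/\ T \in unitmx, T *m Z *m invmx T = - Z^T
    & T \is hermitianmx l tau idfun].

End Matrices.

(* Main.v *)
From HB Require Import structures.
Require Import Defs.
From mathcomp Require Import all_boot all_order all_algebra all_field.
From mathcomp Require Import sesquilinear.
From mathcomp Require Import zify ring.

Set Implicit Arguments.
Unset Strict Implicit.
Unset Printing Implicit Defensive.

Import GRing.Theory passmx.
Local Open Scope ring_scope.

(** Matrices act on row vectors below, so [eta] is represented by [mxof] and the
    matrices of [is_matrix_of] appear transposed.

    An isomorphism of the sextuple with its dual is a nondegenerate bilinear
    form on [U * U * U] pairing [I_i] with [C_i] to zero on both sides. These
    conditions say that the form is determined by its restriction [b] to the
    middle factor, through the pattern of [H_mx], and that
    [b (eta x) y + b x (eta y) = b x y]; in other words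
    [zeta = eta - 1/2] is skew-adjoint for [b] ([self_dual_gram],
    [gram_compatible_form]). So everything is about nondegenerate forms [b] with
    a given skew-adjoint operator [zeta], which is invertible since [1/2] is not
    an eigenvalue of [eta].

    The equivalences. If [b] is such a form and [b'] its transpose, then
    [b + b'] and [b - b'] are the products of [b] with two operators commuting
    with [zeta], of sum [2]. The centralizer of an indecomposable operator is
    local ([indec_comm_local], Fitting), so one of the two is nondegenerate.
    This yields one sign, and composing with [zeta] gives the other
    ([symmetrize_skew_adjoint]). The opposite implications hold for every
    sextuple ([compatible_form_self_dual]).

    The basis. An indecomposable operator annihilated by a power of an
    irreducible polynomial [q] is cyclic ([indec_cyclic]): a Krylov subspace of
    maximal length is complemented by the orthogonal of a dual Krylov subspace,
    because the matrix between them is an invertible Hankel matrix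
    ([hankel_mx_unit]). Irreducible polynomials being separable, Newton
    iteration splits [zeta] into a root of [q] and a commuting nilpotent part
    ([hensel_root]); applying monomials in the two parts to a cyclic vector gives
    the basis of the block Jordan form ([jordan_rows]).

    The matrix [T]. In a suitable basis the Frobenius matrix [Z] is the matrix of
    [zeta] on an invariant subspace, and self-duality makes [zeta] conjugate to
    the negative of its transpose; this forces the polynomial [p] of [Z] to be
    irreducible and even ([frobenius_even]). On [k[x]/p] the forms
    [(f, g) |-> lam (f(x) g(-x))], with [lam] the coefficient of [1] or of [x],
    are symmetric, respectively skew-symmetric, and have multiplication by [x] as
    a skew-adjoint operator ([frobenius_form_exists]). Finally [M_mx m T] is a
    form on [U] for which the whole Jordan block is skew-adjoint: the alternating
    signs deal with the shift ([jordan_mx_skew]). *)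

(** * Polynomials *)

Section Polynomials.
Variable k : fieldType.
Implicit Types (a b f h p q : {poly k}) (e m n : nat).

Lemma dvdp_comp_polyB p a b : a - b %| (p \Po a) - (p \Po b).
Proof.
elim/poly_ind: p => [|p c IHp]; first by rewrite !comp_poly0 subrr dvdp0.
rewrite !comp_poly_MXaddC.
have ->: (p \Po a) * a + c%:P - ((p \Po b) * b + c%:P) =
  ((p \Po a) - (p \Po b)) * a + (p \Po b) * (a - b) by ring.
by apply: dvdp_add; [apply: dvdp_mulr | apply: dvdp_mull].
Qed.

Lemma comp_poly_taylor2 p a h :
  exists r, p \Po (a + h) = (p \Po a) + (p^`() \Po a) * h + r * h ^+ 2.
Proof.
elim/poly_ind: p => [|p c [r IHp]].
  by exists 0; rewrite deriv0 !comp_poly0 !mul0r !addr0.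
exists (r * (a + h) + (p^`() \Po a)).
rewrite derivD derivC addr0 derivM derivX mulr1 !comp_polyD !comp_polyM.
by rewrite !comp_polyX !comp_polyC IHp; ring.
Qed.

(** Newton iteration: [s] approximates a root of [q] in [k[x]/q^m] that reduces
    to the class of [x]; separability makes [q'] invertible at each step. This
    is the Jordan-Chevalley splitting of [x] modulo [q^m]. *)
Lemma hensel_root q m : separable_poly q ->
  exists s, (q ^+ m %| q \Po s) /\ (q %| s - 'X).
Proof.
move=> sep_q; case: m => [|m].
  by exists 'X; rewrite expr0 dvd1p subrr dvdp0.
elim: m => [|m [s [qs sX]]].
  by exists 'X; rewrite expr1 comp_polyXr dvdpp subrr dvdp0.
have /Bezout_eq1_coprimepP[[u t] /= ut1] : coprimep q q^`().
  by move: sep_q; rewrite separable_poly.unlock.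
have [r tay] := comp_poly_taylor2 q s (- ((q \Po s) * t)).
exists (s - (q \Po s) * t); split.
  rewrite tay.
  have ->: (q \Po s) + (q^`() \Po s) * - ((q \Po s) * t)
              + r * (- ((q \Po s) * t)) ^+ 2
         = (q \Po s) * (1 - (q^`() \Po s) * t)
           + (q \Po s) * (q \Po s) * (r * t ^+ 2) by ring.
  rewrite exprSr dvdp_add //.
    apply: dvdp_mul => //; rewrite -ut1.
    have ->: u * q + t * q^`() - (q^`() \Po s) * t
      = u * q + t * ((q^`() \Po 'X) - (q^`() \Po s)).
      by rewrite comp_polyXr; ring.
    rewrite dvdp_add ?dvdp_mull // (dvdp_trans _ (dvdp_comp_polyB _ _ _)) //.
    by rewrite -opprB dvdpNr.
  rewrite dvdp_mulr // dvdp_mul // (dvdp_trans _ qs) //.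
  by rewrite exprS dvdp_mulr.
have ->: s - (q \Po s) * t - 'X = s - 'X - (q \Po s) * t by ring.
by rewrite dvdp_sub // dvdp_mulr // (dvdp_trans _ qs) // exprS dvdp_mulr.
Qed.

Lemma irreducible_coprime q f : irreducible_poly q -> ~~ (q %| f) ->
  coprimep q f.
Proof.
case=> q_gt1 q_irr q_f; rewrite coprimep_def; apply: contraNT q_f => d_neq1.
have /eqpP[[a b] /= /andP[a0 b0] eq_d] := q_irr _ d_neq1 (dvdp_gcdl q f).
by rewrite -(dvdpZl _ _ b0) -eq_d dvdpZl // dvdp_gcdr.
Qed.

(** In [k[x]/q^(e+1)] every nonzero ideal contains the socle, spanned by
    [q^e]. *)
Lemma primary_socle q f e : irreducible_poly q -> ~~ (q ^+ e.+1 %| f) ->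
  exists g w, g * f + w * q ^+ e.+1 = q ^+ e.
Proof.
move=> q_irr; elim: e f => [|e IHe] f.
  rewrite expr1 expr0 => /(irreducible_coprime q_irr).
  case/Bezout_eq1_coprimepP=> [[w g] /= E]; exists g, w.
  by rewrite -E addrC.
have [/dvdpP[f' ->]|q_f] := boolP (q %| f).
  rewrite exprSr dvdp_mul2r ?(irredp_neq0 q_irr) // => /IHe[g [w E]].
  by exists g, w; rewrite [in RHS]exprSr -E exprSr; ring.
move=> _; have := irreducible_coprime q_irr q_f.
move/(coprimep_expl e.+2)=> /Bezout_eq1_coprimepP[[w g] /= E].
exists (q ^+ e.+1 * g), (q ^+ e.+1 * w).
by rewrite -[RHS]mulr1 -E; ring.
Qed.

Lemma irreducible_comp_linear q a b : irreducible_poly q -> size a = 2 ->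
  a \Po b = 'X -> b \Po a = 'X -> irreducible_poly (q \Po a).
Proof.
move=> [q_gt1 q_irr] sz_a ab ba; split; first by rewrite size_comp_poly2.
move=> d d_neq1 d_q.
have b_nc : size b = 2.
  have := congr1 (size : {poly k} -> nat) ba.
  by rewrite size_comp_poly2 // size_polyX.
have : d \Po b %= q.
  apply: q_irr; first by rewrite size_comp_poly2.
  by have := dvdp_comp_poly b d_q; rewrite -comp_polyA ab comp_polyXr.
case/andP=> d1 d2; apply/andP; split=> //.
by have := dvdp_comp_poly a d2; rewrite -comp_polyA ba comp_polyXr.
Qed.

Lemma eqp_irreducible p q : p %= q -> irreducible_poly p -> irreducible_poly q.
Proof.
move=> pq [p_gt1 p_irr]; split; first by rewrite -(eqp_size pq).
by move=> d d_neq1; rewrite -(eqp_dvdr d pq) => /(p_irr d d_neq1)/eqp_trans->.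
Qed.

End Polynomials.

(** * Hankel matrices of functionals on primary quotients *)

Section Hankel.
Variables (k : fieldType) (Lam : {linear {poly k} -> k^o}).
Variables (q : {poly k}) (e d : nat).
Hypotheses (q_irr : irreducible_poly q) (size_qe : size (q ^+ e.+1) = d.+1).
Hypothesis Lam_qe : forall g, Lam (g * q ^+ e.+1) = 0.
Hypothesis Lam_socle : exists h, Lam (h * q ^+ e) != 0.

Definition hankel_mx : 'M[k]_d := \matrix_(i, j) Lam 'X^(i + j).

Lemma functional_modp f : Lam (f %% q ^+ e.+1) = Lam f.
Proof. by rewrite [in RHS](divp_eq f (q ^+ e.+1)) linearD /= Lam_qe add0r. Qed.

Lemma row_hankel (r : 'rV[k]_d) j :
  (r *m hankel_mx) 0 j = Lam (rVpoly r * 'X^j).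
Proof.
rewrite mxE /rVpoly poly_def mulr_suml linear_sum; apply: eq_bigr => i _ /=.
rewrite -scalerAl linearZ /= mxE -exprD; congr (_ * _).
by rewrite valK.
Qed.

(** A nonzero polynomial of degree less than [d] divides the socle generator
    modulo [q^(e+1)], so a vector in the kernel would force [Lam] to vanish on
    the socle. *)
Lemma hankel_mx_unit : hankel_mx \in unitmx.
Proof.
have q0 : q != 0 by apply: irredp_neq0.
rewrite -row_free_unit -kermx_eq0; apply/rowV0P => r /sub_kermxP rH0.
have Lam0 g : Lam (rVpoly r * g) = 0.
  rewrite -functional_modp -modp_mul functional_modp.
  have sz_g : (size (g %% q ^+ e.+1)%R <= d)%N.
    by rewrite -ltnS -size_qe ltn_modp expf_neq0.
  rewrite -(coefK (g %% q ^+ e.+1)) poly_def mulr_sumr linear_sum big1 //= => i _.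
  have lt_i_d := leq_trans (ltn_ord i) sz_g.
  rewrite -scalerAr linearZ /= -(row_hankel r (Ordinal lt_i_d)) rH0 mxE.
  exact: mulr0.
apply/eqP; apply: contraT => r0; have [h /eqP[]] := Lam_socle.
have nd : ~~ (q ^+ e.+1 %| rVpoly r).
  apply: contra r0 => /dvdp_leq; rewrite size_qe => le_sz.
  rewrite -(inj_eq (can_inj (@rVpolyK _ _))) linear0; apply: contraT => /le_sz.
  by rewrite ltnNge size_poly.
have [g [w <-]] := primary_socle q_irr nd.
have ->: h * (g * rVpoly r + w * q ^+ e.+1) =
  rVpoly r * (h * g) + (h * w) * q ^+ e.+1 by ring.
by rewrite linearD /= Lam0 Lam_qe addr0.
Qed.

End Hankel.

(** * Indecomposable matrices *)

Section IndecomposableMatrices.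
Variable k : fieldType.

Definition indec_mx n (A : 'M[k]_n) : Prop :=
  (0 < n)%N /\ forall V W : 'M[k]_n, stablemx V A -> stablemx W A ->
    row_full (V + W)%MS -> (V :&: W)%MS = 0 -> V = 0 \/ W = 0.

Lemma stablemx_shift n (V A : 'M[k]_n) a :
  stablemx V (A - a%:M) = stablemx V A.
Proof.
apply/idP/idP => sVA; last by rewrite stablemxD // stablemxN stablemxC.
by rewrite -(subrK a%:M A) stablemxD // stablemxC.
Qed.

Lemma indec_mx_shift n (A : 'M[k]_n) a : indec_mx A -> indec_mx (A - a%:M).
Proof.
by case=> n_gt0 indA; split=> // V W; rewrite !stablemx_shift; apply: indA.
Qed.

(** [row_full (kermxpoly X p)] says [p(X) = 0] in every dimension, zero
    included. *)
Lemma kermxpoly_char_poly n (X : 'M[k]_n) p :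
  char_poly X %| p -> row_full (kermxpoly X p).
Proof.
case: n X => [|n] X X_p; first by rewrite thinmx0 -col_leq_rank.
rewrite -sub1mx kermxpoly_min //.
exact: dvdp_trans (mxminpoly_dvd_char X) X_p.
Qed.

(** Fitting: the primary decomposition of [X] for the factor ['X] and its
    coprime part is stable under everything that commutes with [X], so [X] is
    invertible or nilpotent. *)
Lemma indec_comm_local n (A X : 'M[k]_n) (a : k) : indec_mx A -> comm_mx X A ->
  a != 0 -> X \in unitmx \/ a%:M - X \in unitmx.
Proof.
move=> [n_gt0 indA] XA a0.
(* The extra factor ['X] makes the multiplicity [s] below positive. *)
have X_char_neq0 : 'X * char_poly X != 0.
  by rewrite mulf_neq0 ?polyX_eq0 ?monic_neq0 ?char_poly_monic.
have [s [g g0 Eg]] := multiplicity_XsubC ('X * char_poly X) 0.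
move: g0; rewrite X_char_neq0 /= => g0; rewrite polyC0 subr0 in Eg.
have cop : coprimep g ('X^s).
  by rewrite coprimep_expr // coprimepX.
have s_gt0 : (0 < s)%N.
  case: s Eg {cop} => // Eg; move: g0; rewrite -[g]mulr1 -(expr0 'X) -Eg.
  by rewrite rootM rootX eqxx.
have full : row_full (kermxpoly X g + kermxpoly X ('X^s))%MS.
  rewrite -sub1mx -(kermxpolyM X cop) -Eg sub1mx.
  by rewrite kermxpoly_char_poly // dvdp_mull.
have [] := indA _ _ (comm_mx_stable_kermxpoly g XA)
  (comm_mx_stable_kermxpoly ('X^s) XA) full (mxdirect_kermxpoly X cop).
  move=> Kg0; right; rewrite Kg0 in full.
  rewrite -row_free_unit -kermx_eq0; apply/rowV0P => v /sub_kermxP.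
  rewrite mulmxBr => /subr0_eq; rewrite mul_mx_scalar => vX.
  have v1 : (v <= kermxpoly X ('X - a%:P))%MS.
    rewrite -eigenspace_poly; apply/eigenspaceP.
    by rewrite -vX.
  have v2 : (v <= kermxpoly X ('X^s))%MS.
    by move: full; rewrite -sub1mx adds0mx => /(submx_trans (submx1 v)).
  apply/eqP; rewrite -submx0 -(mxdirect_kermxpoly X (p := 'X - a%:P) (q := 'X^s)).
    by rewrite sub_capmx v1.
  by rewrite coprimep_expr // coprimepX root_XsubC eq_sym.
move=> Ks0; left; rewrite -row_free_unit -kermx_eq0 -kermxpolyX.
rewrite -submx0 -{1}Ks0.
case: n X A {indA XA X_char_neq0 Eg full} Ks0 n_gt0 => // n X _ _ _.
rewrite /kermxpoly; apply/rV_subP => v /sub_kermxP vX; apply/sub_kermxP.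
by rewrite -(prednK s_gt0) exprS rmorphM /= mulmxA vX mul0mx.
Qed.

(** Two forms for which [A] is skew-adjoint differ by an element of the
    centralizer of [A], which is local. Since [2] is the sum of
    [(G + G^T) G^-1] and [(G - G^T) G^-1], one of [G + G^T] and [G - G^T] is
    nondegenerate. Multiplying it by the skew-adjoint and invertible [A]
    produces the other sign. *)
Lemma symmetrize_skew_adjoint n (A G : 'M[k]_n) (eps : bool) :
  (2%:R : k) != 0 -> indec_mx A -> A \in unitmx -> G \in unitmx ->
  A *m G = - (G *m A^T) ->
  exists H, [/\ H \in unitmx, A *m H = - (H *m A^T)
              & H^T = (-1) ^+ eps *: H].
Proof.
move=> k2 indA uA uG AG.
have AGt : A *m G^T = - (G^T *m A^T).
  have -> : A *m G^T = (G *m A^T)^T by rewrite trmx_mul trmxK.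
  by rewrite -[G *m A^T]opprK -AG linearN /= trmx_mul.
have AiG : A^T *m invmx G = - (invmx G *m A).
  apply: (can_inj (mulKmx uG)); rewrite mulmxN mulKVmx // mulmxA.
  by apply: (can_inj (mulmxK uG)); rewrite mulmxKV // mulNmx AG opprK.
suff [del [H [uH AH Ht]]] : exists del : bool, exists H,
    [/\ H \in unitmx, A *m H = - (H *m A^T) & H^T = (-1) ^+ del *: H].
  have [<-|ne] := eqVneq del eps; first by exists H.
  exists (A *m H); split; first by rewrite unitmx_mul uA.
    by rewrite -mulmxA -mulmxN -AH.
  rewrite trmx_mul Ht -scalemxAl -[H *m _]opprK -AH scalerN -scaleNr.
  by move: ne; case: del {Ht}; case: eps; rewrite /= ?expr0 ?expr1 ?opprK //.
pose X := (G + G^T) *m invmx G.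
have XA : comm_mx X A.
  rewrite /comm_mx /X -mulmxA -[invmx G *m A]opprK -AiG mulmxN mulmxA.
  rewrite mulmxDr AG AGt -opprD mulNmx -mulmxDl; congr (- _).
  by rewrite mulmxA.
have [uX|uX] := indec_comm_local indA XA k2.
  exists false, (G + G^T); split.
  - by have := uX; rewrite unitmx_mul unitmx_inv uG andbT.
  - by rewrite mulmxDr AG AGt mulmxDl opprD.
  - by rewrite expr0 scale1r linearD /= trmxK addrC.
exists true, (G - G^T); split.
- have E : (2%:R)%:M - X = (G - G^T) *m invmx G.
    rewrite /X !mulmxDl mulNmx mulmxV // -scalemx1 scaler_nat mulr2n.
    by rewrite opprD addrACA subrr add0r.
  by move: uX; rewrite E unitmx_mul unitmx_inv uG andbT.
- by rewrite mulmxBr AG AGt mulmxBl opprB opprK addrC.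
- by rewrite expr1 scaleN1r linearB /= trmxK opprB.
Qed.

End IndecomposableMatrices.

(** * Cyclic vectors *)

Section CyclicVectors.
Variable k : fieldType.

Section Krylov.
Variables (n : nat) (A : 'M[k]_n.+1) (v : 'rV[k]_n.+1) (w : 'cV[k]_n.+1).

Definition krylov (f : {poly k}) : k^o := (v *m horner_mx A f *m w) 0 0.

Lemma krylov_linear : linear krylov.
Proof.
move=> a f g; rewrite /krylov linearP mulmxDr -scalemxAr mulmxDl -scalemxAl.
by rewrite !mxE.
Qed.

HB.instance Definition _ := GRing.isSemilinear.Build k {poly k} k^o _ krylov
  (GRing.semilinear_linear krylov_linear).

End Krylov.

(** Let [q^(e+1)] be the exact annihilator, and let [v] and the functional [w]
    be such that [w] does not vanish on [v q^e(A)]. The Krylov space of [v] and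
    the orthogonal of the Krylov space of [w] are invariant, and they are
    complementary because the matrix pairing the two Krylov spaces is an
    invertible Hankel matrix. Indecomposability leaves only the first. *)
Lemma indec_cyclic n (A : 'M[k]_n) q m : indec_mx A -> irreducible_poly q ->
  row_full (kermxpoly A (q ^+ m)) ->
  exists v : 'rV[k]_n, forall V : 'M_n,
    stablemx V A -> (v <= V)%MS -> row_full V.
Proof.
move=> indA q_irr; have q0 := irredp_neq0 q_irr.
case: n A indA => [|n] A [//] _ indA.
rewrite -sub1mx => /sub_kermxP; rewrite mul1mx => qmA.
have exq : exists e, horner_mx A (q ^+ e) == 0 by exists m; apply/eqP.
case: (ex_minnP exq) => [[|e]]; first by rewrite expr0 rmorph1 oner_eq0.
move=> /eqP qA min_e; set Q := q ^+ e.+1 in qA.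
have : horner_mx A (q ^+ e) != 0.
  by apply/negP => /min_e; rewrite ltnn.
case/matrix0Pn=> i0 [j0 Bij].
pose v : 'rV[k]_n.+1 := delta_mx 0 i0; pose w : 'cV[k]_n.+1 := delta_mx j0 0.
pose d := (size Q).-1.
have size_Q : size Q = d.+1 by rewrite /d prednK // size_poly_gt0 expf_neq0.
pose Psi : 'M_(d, n.+1) := \matrix_(i < d) (v *m A ^+ i).
pose Phi : 'M_(n.+1, d) := \matrix_(a < n.+1, j < d) (A ^+ j *m w) a 0.
have expand f : exists c : 'rV[k]_d,
    horner_mx A f = \sum_(i < d) c 0 i *: A ^+ i.
  exists (poly_rV (f %% Q)).
  rewrite {1}(divp_eq f Q) rmorphD rmorphM /= qA mulr0 add0r.
  have szR : (size (f %% Q)%R <= d)%N.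
    by rewrite -ltnS -size_Q ltn_modp expf_neq0.
  rewrite -[in LHS](poly_rV_K szR) /rVpoly poly_def linear_sum /=.
  apply: eq_bigr => i _; rewrite linearZ /= rmorphXn /= horner_mx_X valK.
  by rewrite mxE.
have PhiE (x : 'rV_n.+1) j : (x *m Phi) 0 j = (x *m A ^+ j *m w) 0 0.
  by rewrite -mulmxA [LHS]mxE [RHS]mxE; apply: eq_bigr => t _; rewrite !mxE.
have PsiPhi : Psi *m Phi = hankel_mx (krylov A v w) d.
  apply/row_matrixP => i; apply/rowP => j.
  rewrite row_mul rowK PhiE -[v *m _ *m _]mulmxA mulmxE -exprD [RHS]mxE.
  by rewrite [RHS]mxE /= /krylov rmorphXn /= horner_mx_X.
have uH : Psi *m Phi \in unitmx.
  rewrite PsiPhi; apply: (hankel_mx_unit q_irr size_Q) => [g|].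
    by rewrite /= /krylov rmorphM /= qA mulr0 mulmx0 mul0mx mxE.
  exists 1; rewrite mul1r /= /krylov /v /w -rowE -colE !mxE //.
have memPsi f : (v *m horner_mx A f <= Psi)%MS.
  have [c ->] := expand f; rewrite mulmx_sumr summx_sub // => i _.
  rewrite -scalemxAr scalemx_sub // (eq_row_sub i) // rowK //.
have kerPhi (u : 'rV_n.+1) f :
    (u <= kermx Phi)%MS -> u *m horner_mx A f *m w = 0.
  move/sub_kermxP => uPhi; have [c ->] := expand f.
  rewrite mulmx_sumr mulmx_suml big1 // => i _.
  rewrite -scalemxAr -scalemxAl; apply/eqP; rewrite scaler_eq0.
  apply/orP; right; apply/eqP/matrixP => a b.
  by rewrite !ord1 -PhiE uPhi !mxE.
have stPsi : stablemx <<Psi>>%MS A.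
  rewrite (eqmxMr _ (genmxE _)) genmxE; apply/row_subP => i.
  rewrite row_mul rowK -mulmxA.
  have -> : A ^+ i *m A = horner_mx A ('X ^+ i.+1).
    by rewrite rmorphXn /= horner_mx_X exprSr.
  exact: memPsi.
have stPhi : stablemx (kermx Phi) A.
  apply/rV_subP => _ /submxP[c ->]; rewrite mulmxA.
  set u := c *m kermx Phi.
  have uPhi : (u <= kermx Phi)%MS by rewrite submxMl.
  apply/sub_kermxP/rowP => j; rewrite PhiE -[u *m A *m _]mulmxA mulmxE -exprS.
  have := kerPhi u ('X ^+ j.+1) uPhi; rewrite rmorphXn /= horner_mx_X => ->.
  by rewrite !mxE.
have full : row_full (<<Psi>> + kermx Phi)%MS.
  rewrite -sub1mx -(subrK (Phi *m invmx (Psi *m Phi) *m Psi) 1%:M) addrC.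
  apply: addmx_sub_adds; first by rewrite genmxE submxMl.
  apply/sub_kermxP; rewrite mulmxBl mul1mx -[_ *m Psi *m Phi]mulmxA.
  by rewrite mulmxKV // subrr.
have cap0 : (<<Psi>> :&: kermx Phi)%MS = 0.
  apply/eqP/rowV0P => u; rewrite sub_capmx genmxE => /andP[/submxP[c ->]].
  move/sub_kermxP; rewrite -mulmxA => cH0.
  by rewrite -[c](mulmxK uH) cH0 !mul0mx.
exists v => V stV vV.
case: (indA _ _ stPsi stPhi full cap0) => [Psi0|Phi0].
  have := memPsi (q ^+ e); rewrite -(genmxE Psi) Psi0 submx0 => /eqP.
  move/(congr1 (fun M : 'rV_n.+1 => M 0 j0)); rewrite -rowE !mxE => Bij0.
  by rewrite Bij0 eqxx in Bij.
move: full; rewrite Phi0 -!sub1mx addsmx0 genmxE => /submx_trans; apply.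
apply/row_subP => i; rewrite rowK; elim: (i : nat) => [|j IHj].
  by rewrite expr0 mulmx1.
by rewrite exprSr mulmxA (submx_trans (submxMr A IHj)).
Qed.

End CyclicVectors.

(** * Frobenius matrices *)

Section Frobenius.
Variables (k : fieldType) (l : nat) (p : {poly k}).
Hypotheses (p_monic : p \is monic) (size_p : size p = l.+1).
Local Notation Z := (frobenius_mx l p).

Lemma frobenius_col (j : 'I_l) :
  \sum_(i < l) Z i j *: 'X^i = 'X^(j.+1) - (p *+ (j.+1 == l)).
Proof.
have [El|ne] := eqVneq j.+1 l.
  rewrite mulr1n {1}El -[X in _ = _ - X]coefK poly_def size_p big_ord_recr /=.
  have -> : p`_l = 1 by move/monicP: p_monic; rewrite lead_coefE size_p.
  rewrite scale1r opprD addrCA subrr addr0 -sumrN; apply: eq_bigr => i _.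
  by rewrite mxE El eqxx scaleNr.
have lt_j : (j.+1 < l)%N by rewrite ltn_neqAle ne ltn_ord.
rewrite mulr0n subr0 (bigD1 (Ordinal lt_j)) //= mxE (negPf ne) eqxx scale1r.
rewrite big1 ?addr0 // => i; rewrite -val_eqE /= mxE (negPf ne) => /negPf->.
by rewrite scale0r.
Qed.

Lemma char_poly_frobenius : char_poly Z = p.
Proof.
rewrite -[RHS](companionmxK p_monic) /char_poly -det_tr.
have El : l = (size p).-1 by rewrite size_p.
have E : forall (d : nat) (X : 'M[k]_d) (Y : 'M[k]_l) (e : l = d),
    castmx (e, e) Y = X -> \det (char_poly_mx Y) = \det (char_poly_mx X).
  by move=> d X Y e; case: d / e X => X <-; rewrite castmx_id.
rewrite -(E _ _ Z^T El).
  by congr (\det _); apply/matrixP => i j; rewrite !mxE eq_sym.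
apply/matrixP => i j; rewrite castmxE !mxE /=.
have -> : (i.+1 == l) = (i == (size p).-1.-1 :> nat).
  by have := ltn_ord i; move: (nat_of_ord i) => a; rewrite -El; lia.
by rewrite [j == _ :> nat]eq_sym.
Qed.

(** The [j]-th column of the Frobenius matrix expresses [x^(j+1)] modulo [p], so
    the vectors [v s(A)^j B] are transformed by [s(A)] according to it as soon as
    [p(s(A))] kills them. *)
Lemma frobenius_horner_row n (A : 'M[k]_n.+1) (v : 'rV_n.+1) (B : 'M_n.+1)
    (s : {poly k}) (P := \matrix_(j < l) (v *m horner_mx A (s ^+ j) *m B)) :
  comm_mx (horner_mx A s) B -> v *m horner_mx A (p \Po s) *m B = 0 ->
  P *m horner_mx A s = Z^T *m P.
Proof.
move=> sB ps0; apply/row_matrixP => j; rewrite !row_mul rowK.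
rewrite -mulmxA -sB mulmxA -[v *m _ *m _]mulmxA mulmxE -rmorphM -exprSr /=.
have -> : s ^+ j.+1 = \sum_(i < l) Z i j *: s ^+ i + (p \Po s) *+ (j.+1 == l).
  have := congr1 (comp_poly s) (frobenius_col j).
  rewrite linear_sum linearB /= comp_Xn_poly linearMn /= => E.
  rewrite -[LHS](subrK ((p \Po s) *+ (j.+1 == l))) -E; congr (_ + _).
  by apply: eq_bigr => i _; rewrite linearZ /= comp_Xn_poly.
rewrite rmorphD rmorphMn /= mulmxDr mulmxDl.
have -> : v *m (horner_mx A (p \Po s) *+ (j.+1 == l)) *m B = 0.
  by case: eqP => _; rewrite ?mulr1n // mulr0n mulmx0 mul0mx.
rewrite addr0 linear_sum /= mulmx_sumr mulmx_suml mulmx_sum_row.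
apply: eq_bigr => i _; rewrite linearZ /= -scalemxAr -scalemxAl rowK.
by rewrite !mxE.
Qed.

End Frobenius.

Section FrobeniusForm.
Variables (k : fieldType) (l : nat) (p : {poly k}) (tau : bool).
Hypotheses (p_monic : p \is monic) (size_p : size p = l.+1).
Hypotheses (p_irr : irreducible_poly p) (p_even : p \Po - 'X = p).
Hypotheses (k2 : (2%:R : k) != 0) (l_gt1 : (1 < l)%N).
Local Notation Z := (frobenius_mx l p).

Definition rem_coef (f : {poly k}) : k^o := (f %% p)`_tau.

Lemma rem_coef_linear : linear rem_coef.
Proof. by move=> a f g; rewrite /rem_coef modpD modpZl coefD coefZ. Qed.

HB.instance Definition _ := GRing.isSemilinear.Build k {poly k} k^o _ rem_coef
  (GRing.semilinear_linear rem_coef_linear).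

Lemma coef_comp_polyN (f : {poly k}) i : (f \Po - 'X)`_i = (-1) ^+ i * f`_i.
Proof.
have -> : - 'X = (-1) *: 'X :> {poly k} by rewrite scaleN1r.
rewrite comp_polyE coef_sum.
under eq_bigr => j _ do rewrite exprZn scalerA coefZ coefXn.
have [lt_i|le_i] := ltnP i (size f); last first.
  rewrite big1 => [|j _]; first by rewrite nth_default ?mulr0.
  by rewrite gtn_eqF ?mulr0 // (leq_trans (ltn_ord j)).
rewrite (bigD1 (Ordinal lt_i)) //= eqxx mulr1 big1 ?addr0 1?mulrC // => j.
by rewrite -val_eqE eq_sym /= => /negPf->; rewrite mulr0.
Qed.

Lemma size_comp_polyN (f : {poly k}) : size (f \Po - 'X) = size f.
Proof. by rewrite size_comp_poly2 // size_polyN size_polyX. Qed.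

Lemma even_poly_coef i : odd i -> p`_i = 0.
Proof.
move=> odd_i; have := coef_comp_polyN p i; rewrite p_even -signr_odd odd_i.
rewrite expr1 mulN1r => /eqP; rewrite -addr_eq0 -mulr2n -mulr_natl mulf_eq0.
by rewrite (negPf k2) => /eqP.
Qed.

Lemma even_poly_degree : ~~ odd l.
Proof.
apply: contraL (monic_neq0 p_monic) => /even_poly_coef p_l.
by rewrite negbK -lead_coef_eq0 lead_coefE size_p p_l.
Qed.

(** Reduction modulo the even polynomial [p] commutes with [x -> -x], so the
    remainder of [x^i] has the parity of [i]. *)
Lemma rem_coef_parity i : odd i != tau -> rem_coef 'X^i = 0.
Proof.
move=> par; have sz : (size (('X^i %% p) \Po - 'X) < size p)%N.
  by rewrite size_comp_polyN ltn_modp monic_neq0.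
have E : ('X^i %% p) \Po - 'X = (-1) ^+ i *: ('X^i %% p).
  rewrite -[LHS](modp_small sz) -modpZl.
  have -> : ('X^i %% p) \Po - 'X = (-1) ^+ i *: 'X^i
      - ((('X^i %/ p) \Po - 'X) * p).
    have -> : (('X^i %/ p) \Po - 'X) * p = ('X^i %/ p * p) \Po - 'X.
      by rewrite comp_polyM p_even.
    have -> : (-1) ^+ i *: 'X^i = 'X^i \Po - 'X :> {poly k}.
      by rewrite comp_Xn_poly -scaleN1r exprZn.
    by rewrite {2}(divp_eq 'X^i p) comp_polyD addrAC subrr add0r.
  by rewrite modpD modpN modp_mull oppr0 addr0.
have := congr1 (fun f : {poly k} => f`_tau) E.
rewrite coef_comp_polyN coefZ -/(rem_coef _) -[(-1) ^+ i]signr_odd => /eqP.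
rewrite -subr_eq0 -mulrBl mulf_eq0 => /orP[|/eqP//].
move: par; case: (odd i); case: tau => //= _.
  by rewrite ?expr0 ?expr1 opprK -[1 + 1]/(2%:R) (negPf k2).
by rewrite ?expr0 ?expr1 -opprD oppr_eq0 -[1 + 1]/(2%:R) (negPf k2).
Qed.

Local Notation W := (hankel_mx rem_coef l).

(** [1 < l] places the index [tau] among the coefficients of a remainder, so that
    the functional is nonzero. *)
Lemma rem_coef_hankel_unit : W \in unitmx.
Proof.
apply: (@hankel_mx_unit _ _ p 0) => //.
  by move=> g; rewrite expr1 /= /rem_coef modp_mull coef0.
exists 'X^tau; rewrite expr0 mulr1 /= /rem_coef modp_small.
  by rewrite coefXn eqxx oner_eq0.
by rewrite size_polyXn size_p ltnS (leq_ltn_trans (leq_b1 _)).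
Qed.

Lemma frobenius_hankel (i j : 'I_l) : (W *m Z) i j = rem_coef 'X^(i + j.+1).
Proof.
rewrite mxE.
have -> : 'X^(i + j.+1) =
    'X^i * (\sum_(a < l) Z a j *: 'X^a + p *+ (j.+1 == l)) :> {poly k}.
  by rewrite frobenius_col // subrK exprD.
rewrite mulrDr linearD /=.
have -> : rem_coef ('X^i * (p *+ (j.+1 == l))) = 0.
  by rewrite /rem_coef mulrnAr -mulrnAl modp_mull coef0.
rewrite addr0 mulr_sumr linear_sum /=; apply: eq_bigr => a _.
by rewrite mxE -scalerAr linearZ /= exprD mulrC.
Qed.

(** Multiplication by [x] on [k[x]/p] is self-adjoint for the Hankel form of any
    functional. Composing one argument with the substitution [x -> -x], which
    descends to [k[x]/p] because [p] is even, makes it skew-adjoint. The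
    functional that reads off the coefficient of [x^tau] is even or odd under
    this substitution according to [tau], and this decides the symmetry of the
    form. *)
Lemma frobenius_form_exists : exists T : 'M[k]_l,
  [/\ T \in unitmx, T *m Z = - (Z^T *m T) & T^T = (-1) ^+ tau *: T].
Proof.
pose D : 'M[k]_l := diag_mx (\row_j (-1) ^+ j).
have uD : D \in unitmx.
  rewrite unitmxE det_diag unitfE; apply/prodf_neq0 => i _.
  by rewrite mxE signr_eq0.
have DZ : D *m Z = - (Z *m D).
  apply/matrixP => i j; rewrite mul_diag_mx [RHS]mxE mul_mx_diag !mxE.
  case: ifP => [/eqP El|_]; last first.
    by case: eqP => [->|]; rewrite ?mulr0 ?mul0r ?oppr0 // exprS mulr1 mul1r
      mulN1r.
  have [odd_i|ev_i] := boolP (odd i).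
    by rewrite even_poly_coef // oppr0 mulr0 mul0r oppr0.
  have odd_j : odd j.
    by have := congr1 odd El; rewrite (negPf even_poly_degree) => /negbFE.
  rewrite -signr_odd (negPf ev_i) -[(-1) ^+ j]signr_odd odd_j expr0 expr1.
  by rewrite mul1r mulrN1 opprK.
have Wt : W^T = W by apply/matrixP => i j; rewrite !mxE addnC.
have ZW : Z^T *m W = W *m Z.
  rewrite -[in LHS]Wt -trmx_mul; apply/matrixP => i j.
  by rewrite mxE !frobenius_hankel !addnS addnC.
exists (W *m D); split; first by rewrite unitmx_mul uD rem_coef_hankel_unit.
  by rewrite -mulmxA DZ mulmxN !mulmxA ZW.
rewrite trmx_mul Wt tr_diag_mx; apply/matrixP => i j.
rewrite mul_diag_mx [RHS]mxE mul_mx_diag !mxE /=.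
have [par|/rem_coef_parity->] := eqVneq (odd (i + j)) tau; last first.
  by rewrite mul0r !mulr0.
have -> : (-1) ^+ tau = (-1) ^+ i * (-1) ^+ j :> k.
  by rewrite -exprD -[RHS]signr_odd par.
rewrite -mulrA; congr (_ * _).
by rewrite mulrCA -exprD addnn -signr_odd odd_double mulr1.
Qed.

End FrobeniusForm.

(** * Block matrices *)

Lemma hermitianmx_idE (k : fieldType) n (M : 'M[k]_n) (eps : bool) :
  (M \is hermitianmx n eps idfun) = (M == (-1) ^+ eps *: M^T).
Proof. by rewrite qualifE eq_map_mx_id. Qed.

Lemma hermitianmx_idP (k : fieldType) n (M : 'M[k]_n) (eps : bool) :
  reflect (M^T = (-1) ^+ eps *: M) (M \is hermitianmx n eps idfun).
Proof.
rewrite hermitianmx_idE; apply: (iffP eqP) => [{2}->|->].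
  by rewrite scalerA -expr2 sqrr_sign scale1r.
by rewrite scalerA -expr2 sqrr_sign scale1r.
Qed.

Section BlockMatrices.
Variables (k : fieldType) (m l : nat).
Implicit Types (T Z : 'M[k]_l).

Definition block_shift : 'M[k]_(\sum_(i < m) l) :=
  \mxblock_(i < m, j < m) (if j == i.+1 :> nat then 1%:M else 0 : 'M[k]_l).

Lemma upper_shift_exp n a (i j : 'I_n) :
  (upper_shift k n ^+ a) i j = (j == (i + a)%N :> nat)%:R.
Proof.
elim: a j => [|a IHa] j; first by rewrite expr0 addn0 !mxE eq_sym.
rewrite exprSr mxE; under eq_bigr => b _ do rewrite IHa mxE.
have [Ej|ne] := eqVneq (nat_of_ord j) (i + a.+1)%N.
  have lt_b : (i + a < n)%N by have := ltn_ord j; rewrite Ej; lia.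
  rewrite (bigD1 (Ordinal lt_b)) //= eqxx mul1r Ej addnS eqxx big1 ?addr0 // => b.
  by rewrite -val_eqE /= => /negPf->; rewrite mul0r.
rewrite big1 // => b _; case: eqP => [->|]; rewrite ?mul0r // mul1r.
by rewrite -addnS (negPf ne).
Qed.

Lemma block_index (s : 'I_(\sum_(i < m) l)) :
  s = (tagnat.sig1 s * l + tagnat.sig2 s)%N :> nat.
Proof.
rewrite [LHS]tagnat.rect; congr (_ + _)%N.
rewrite -(big_ord_widen m (fun=> l) (ltnW (ltn_ord (tagnat.sig1 s)))).
by rewrite sum_nat_const card_ord.
Qed.

(** Moving by [l] in the lexicographic enumeration of the pairs (block, position)
    moves to the next block at the same position. *)
Lemma upper_shift_block : upper_shift k (\sum_(i < m) l) ^+ l = block_shift.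
Proof.
apply/matrixP => s t; rewrite upper_shift_exp mxE.
rewrite (block_index s) (block_index t).
move: (tagnat.sig1 s) (tagnat.sig2 s) (tagnat.sig1 t) (tagnat.sig2 t).
move=> a b a' b'; have lt_b := ltn_ord b; have lt_b' := ltn_ord b'.
rewrite -addnAC -mulSnr.
case: (eqVneq (nat_of_ord a') a.+1) => [->|ne].
  by rewrite eqn_add2l mxE eq_sym.
rewrite mxE; case: eqP => // E; case/eqP: ne.
have := congr1 (fun x => x %/ l)%N E.
by rewrite !divnMDl ?(leq_ltn_trans _ lt_b) // !divn_small // !addn0.
Qed.

Lemma jordan_mx_split Z : jordan_mx m Z = \mxdiag_(i < m) Z + block_shift.
Proof. by rewrite /jordan_mx upper_shift_block. Qed.

Lemma jordan_mx_shift a Z : jordan_mx m (a%:M + Z) = a%:M + jordan_mx m Z.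
Proof.
by rewrite /jordan_mx addrA -(mxdiagZ (p_ := fun _ : 'I_m => l)) -mxdiagD.
Qed.

Lemma block_shift_sum (V : nmodType) (F : nat -> V) (i : 'I_m) :
  \sum_(a < m) (if i == a.+1 :> nat then F a else 0) =
  if (i : nat) is i'.+1 then F i' else 0.
Proof.
case Ei: (nat_of_ord i) => [|i']; first by rewrite big1.
have lt_i' : (i' < m)%N by have := ltn_ord i; rewrite Ei; lia.
rewrite (bigD1 (Ordinal lt_i')) //= eqxx big1 ?addr0 // => a.
by rewrite -val_eqE /= eqSS eq_sym => /negPf->.
Qed.

(** The signs alternate along the antidiagonal exactly so that the shift, which
    moves an entry one step against it, becomes skew-adjoint. *)
Lemma jordan_mx_skew T Z : T *m Z = - (Z^T *m T) ->
  (jordan_mx m Z)^T *m M_mx m T = - (M_mx m T *m jordan_mx m Z).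
Proof.
move=> TZ; rewrite jordan_mx_split linearD /= tr_mxdiag mulmxDl mulmxDr opprD.
congr (_ + _).
  rewrite /M_mx mul_mxdiag_mxblock mul_mxblock_mxdiag -mxblockN.
  apply: eq_mxblock => i j; case: eqP => _; last by rewrite mulmx0 mul0mx oppr0.
  by rewrite -scalemxAr -scalemxAl TZ scalerN opprK.
pose F (i j : nat) : 'M[k]_l := if (i + j).+1 == m then (-1) ^+ j *: T else 0.
rewrite /block_shift tr_mxblock /M_mx !mul_mxblock -mxblockN.
apply: eq_mxblock => i j.
rewrite (eq_bigr (fun a : 'I_m => if i == a.+1 :> nat then F a j else 0)).
  rewrite [X in - X](eq_bigr (fun a : 'I_m =>
    if j == a.+1 :> nat then F i a else 0)).
    rewrite (block_shift_sum (F^~ j) i) (block_shift_sum (F i) j) /F.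
    have := ltn_ord i; have := ltn_ord j.
    case: (nat_of_ord i) (nat_of_ord j) => [|i'] [|j'] lt_j lt_i.
    - by rewrite oppr0.
    - by rewrite add0n ltn_eqF // oppr0.
    - by rewrite addn0 ltn_eqF // oppr0.
    - rewrite addnS addSn; case: eqP => _; last by rewrite oppr0.
      by rewrite exprS mulN1r scaleNr.
  by move=> a _; rewrite /F; case: (j == _ :> nat); rewrite ?mulmx1 ?mulmx0.
by move=> a _; rewrite /F; case: (i == _ :> nat);
  rewrite ?trmx1 ?mul1mx ?trmx0 ?mul0mx.
Qed.

Lemma M_mx_unit T : T \in unitmx -> M_mx m T \in unitmx.
Proof.
move=> uT; pose N : 'M[k]_(\sum_(i < m) l) := \mxblock_(i < m, j < m)
  if (i + j).+1 == m then (-1) ^+ i *: invmx T else 0.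
suff : M_mx m T *m N = 1%:M by case/mulmx1_unit.
rewrite mul_mxblock -(mxdiagZ (p_ := fun _ : 'I_m => l)) /mxdiag.
apply: eq_mxblock => i j; rewrite conform_mx_id.
rewrite (bigD1 (rev_ord i)) //= big1 ?addr0 => [|a ne_a]; last first.
  case: eqP => [Em|]; last by rewrite mul0mx.
  case/eqP: ne_a; apply: val_inj => /=; lia.
have lt_i := ltn_ord i; rewrite ifT; last by apply/eqP; lia.
have -> : ((m - i.+1 + j).+1 == m) = (i == j).
  by rewrite -val_eqE /=; have := ltn_ord j; lia.
case: eqP => _; last by rewrite mulmx0.
rewrite -scalemxAl -scalemxAr scalerA -exprD addnn -signr_odd odd_double.
by rewrite scale1r mulmxV.
Qed.

Lemma M_mx_hermitian T eps : (0 < m)%N ->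
  (M_mx m T \is hermitianmx _ eps idfun) =
  (T \is hermitianmx _ (odd m.+1 (+) eps) idfun).
Proof.
move=> m_gt0.
have sgn (i j : nat) : (i + j).+1 = m ->
    (-1) ^+ eps * (-1) ^+ i = (-1) ^+ j * (-1) ^+ (odd m.+1 (+) eps) :> k.
  have jj : (-1) ^+ j * (-1) ^+ j = 1 :> k.
    by rewrite -exprD addnn -signr_odd odd_double.
  move=> <-; rewrite signr_addb signr_odd !exprS !mulN1r opprK exprD.
  by rewrite -[LHS]mul1r -[X in X * _]jj; ring.
rewrite !hermitianmx_idE.
have Mt : (-1) ^+ eps *: (M_mx m T)^T = \mxblock_(i < m, j < m)
    if (i + j).+1 == m then (-1) ^+ j *: ((-1) ^+ (odd m.+1 (+) eps) *: T^T)
    else 0.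
  rewrite tr_mxblock -mul_scalar_mx -(mxdiagZ (p_ := fun _ : 'I_m => l)).
  rewrite mul_mxdiag_mxblock; apply: eq_mxblock => i j.
  rewrite mul_scalar_mx addnC; case: eqP => [Em|_]; last first.
    by rewrite trmx0 scaler0.
  by rewrite linearZ /= !scalerA (sgn i j).
apply/eqP/eqP => [E|ET]; last first.
  by rewrite Mt -ET.
move: E; rewrite Mt /M_mx => /eq_mxblockP/(_ (rev_ord (Ordinal m_gt0))).
move/(_ (Ordinal m_gt0)) => /=.
by rewrite addn0 subn1 prednK // eqxx expr0 !scale1r.
Qed.

Lemma H_mx_hermitian n (M : 'M[k]_n) (eps : bool) :
  (H_mx M \is hermitianmx _ eps idfun) = (M \is hermitianmx _ eps idfun).
Proof.
rewrite !hermitianmx_idE /H_mx.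
rewrite tr_block_mx tr_row_mx tr_col_mx tr_block_mx !linear0 /=.
rewrite scale_block_mx scale_row_mx scale_col_mx scale_block_mx !scaler0.
rewrite !linearN /=.
apply/eqP/eqP => [|<-] //.
by case/eq_block_mx => _ _ _ /eq_block_mx[].
Qed.

End BlockMatrices.

(** * The generalized Jordan block *)

(** With [s] from the Hensel lemma, [A = s(A) + (A - s(A))] splits [A] into a
    root of [q] and a commuting nilpotent part, and the rows
    [v s(A)^j (A - s(A))^(m-1-i)] are moved by the two parts as the diagonal
    and the shift of the block Jordan matrix prescribe. They span because
    their span is invariant and contains the cyclic vector. *)
Lemma jordan_rows (k : fieldType) n (A : 'M[k]_n) (q : {poly k}) l m
    (v : 'rV[k]_n) :
  (0 < m)%N -> (0 < l)%N -> (0 < n)%N ->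
  q \is monic -> size q = l.+1 -> separable_poly q ->
  row_full (kermxpoly A (q ^+ m)) ->
  (forall V : 'M_n, stablemx V A -> (v <= V)%MS -> row_full V) ->
  exists P : 'M[k]_(\sum_(i < m) l, n),
    row_full P /\ P *m A = (jordan_mx m (frobenius_mx l q))^T *m P.
Proof.
move=> m_gt0 l_gt0; case: n A v => // n A v _ q_monic size_q q_sep.
rewrite -sub1mx => /sub_kermxP; rewrite mul1mx => qmA cyc.
have [s [qms sX]] := hensel_root m q_sep.
have qs0 : horner_mx A (q \Po s) = 0.
  by have /dvdpP[f ->] := qms; rewrite rmorphM /= qmA mulr0.
have nilp : horner_mx A (('X - s) ^+ m) = 0.
  have : q ^+ m %| ('X - s) ^+ m by rewrite dvdp_exp2r // -opprB dvdpNr.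
  by case/dvdpP=> f ->; rewrite rmorphM /= qmA mulr0.
pose Pb (i : nat) : 'M[k]_(l, n.+1) := \matrix_(j < l)
  (v *m horner_mx A (s ^+ j) *m horner_mx A (('X - s) ^+ (m - i.+1))).
have Pb_s i : Pb i *m horner_mx A s = (frobenius_mx l q)^T *m Pb i.
  apply: frobenius_horner_row => //; first exact: comm_horner_mx2.
  by rewrite qs0 mulmx0 mul0mx.
have Pb_nu i : Pb i *m horner_mx A ('X - s) =
    if i is i'.+1 then if (i < m)%N then Pb i' else Pb i *m horner_mx A ('X - s)
    else 0.
  case: i => [|i].
    apply/row_matrixP => j; rewrite row_mul rowK row0 -mulmxA mulmxE.
    by rewrite -rmorphM -exprSr /= subn1 prednK // nilp mulmx0.
  case: ifP => // lt_i; apply/row_matrixP => j; rewrite row_mul !rowK -mulmxA.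
  by rewrite mulmxE -rmorphM -exprSr /= subnSK.
pose P : 'M_(\sum_(i < m) l, n.+1) := \mxcol_(i < m) Pb i.
have PA : P *m A = (jordan_mx m (frobenius_mx l q))^T *m P.
  have A_split : A = horner_mx A s + horner_mx A ('X - s).
    by rewrite -rmorphD /= addrC subrK horner_mx_X.
  rewrite [in LHS]A_split mulmxDr jordan_mx_split [X in X *m P]linearD /=.
  rewrite mulmxDl; congr (_ + _).
    rewrite /P mxcol_mul tr_mxdiag mul_mxdiag_mxcol.
    by apply: eq_mxcol => i; rewrite Pb_s.
  rewrite /P mxcol_mul /block_shift tr_mxblock mul_mxblock_mxrow.
  apply: eq_mxcol => i.
  rewrite (eq_bigr (fun a : 'I_m => if i == a.+1 :> nat then Pb a else 0)).
    rewrite (block_shift_sum Pb i) Pb_nu; have := ltn_ord i.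
    by case: (nat_of_ord i) => // i' ->.
  by move=> a _; case: (i == _ :> nat); rewrite ?trmx1 ?mul1mx ?trmx0 ?mul0mx.
exists P; split=> //.
have : row_full <<P>>%MS.
  apply: cyc; first by rewrite (eqmxMr _ (genmxE _)) genmxE PA submxMl.
  have last_m : (m.-1 < m)%N by rewrite prednK.
  have -> : v = row (Ordinal l_gt0) (Pb (Ordinal last_m)).
    rewrite rowK /= prednK // subnn !expr0 !rmorph1.
    by rewrite -[1]/(1%:M) !mulmx1.
  have -> : Pb (Ordinal last_m) = submxcol P (Ordinal last_m) by rewrite mxcolK.
  rewrite genmxE (submx_trans (row_sub _ _)) //.
  by apply/row_subP => j; rewrite row_rowsub row_sub.
by rewrite -!sub1mx genmxE.
Qed.

(** * Compatible forms and self-duality *)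

Section DualOfForm.
Variables (k : fieldType) (V : vectType k).

Lemma linear_form_separates (W : {vspace V}) v : v \notin W ->
  exists2 g : 'Hom(V, k^o), {in W, forall w, g w = 0} & g v != 0.
Proof.
move=> vW; pose u := v - projv W v.
have u0 : u != 0.
  by apply: contra vW; rewrite subr_eq0 => /eqP->; apply: memv_proj.
have [i ui0] : exists i, coord (vbasis {:V}) i u != 0.
  apply/existsP; apply: contraNT u0 => /existsPn/= ui0.
  rewrite [u](coord_vbasis (memvf u)) big1 // => i _.
  by move/negbNE/eqP: (ui0 i) => ->; rewrite scale0r.
exists (linfun (coord (vbasis {:V}) i : V -> k^o) \o (\1 - projv W))%VF.
  move=> w wW; rewrite comp_lfunE lfunE /= add_lfunE opp_lfunE id_lfunE.
  by rewrite projv_id // subrr linear0.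
by rewrite comp_lfunE lfunE /= add_lfunE opp_lfunE id_lfunE.
Qed.

Variables (eps : bool) (B : {hermitian V for eps & idfun}).

Definition form_to_dual_fun (v : V) : 'Hom(V, k^o) := linfun (B v : V -> k^o).

Lemma form_to_dual_linear : linear form_to_dual_fun.
Proof.
move=> a u v; apply/lfunP => w.
by rewrite add_lfunE scale_lfunE !lfunE /= linearPl.
Qed.

HB.instance Definition _ := GRing.isSemilinear.Build k V 'Hom(V, k^o) _
  form_to_dual_fun (GRing.semilinear_linear form_to_dual_linear).

Definition form_to_dual : 'Hom(V, dual_space V) := linfun form_to_dual_fun.

Lemma form_to_dualE v w : form_to_dual v w = B v w.
Proof. by rewrite lfunE /= lfunE. Qed.

Lemma form_to_dual_bij : nondegenerate B ->
  lker form_to_dual == 0%VS /\ limg form_to_dual = fullv.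
Proof.
move=> /eqP ndB; have ker0 : lker form_to_dual == 0%VS.
  rewrite -subv0 -ndB; apply/subvP => v; rewrite memv_ker => /eqP fv0.
  by apply/mem_orthovP => w _; rewrite -form_to_dualE fv0 lfunE.
split=> //; apply/eqP; rewrite eqEdim subvf /= limg_dim_eq.
  by rewrite !dimvf /dim /= muln1.
by rewrite (eqP ker0) capv0.
Qed.

(** That [v] belongs to [I_i] when [B v] annihilates [C_i] is the double
    orthogonal property: otherwise some linear form vanishes on [I_i] but not at
    [v]; it is [B w] for a vector [w], which lies in the orthogonal [C_i] of
    [I_i], a contradiction. *)
Lemma compatible_form_self_dual (S : sextuple V) :
  compatible_form S B -> self_dual S.
Proof.
move=> [ndB compB]; have [ker0 img] := form_to_dual_bij ndB.
have surj (g : 'Hom(V, k^o)) : exists v, g = form_to_dual v.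
  have : g \in limg form_to_dual by rewrite img memvf.
  by case/memv_imgP => v _ ->; exists v.
exists form_to_dual; split=> [|i|i].
- exists (form_to_dual^-1)%VF => [v|g]; first exact: (lker0_lfunK ker0).
  by have [v ->] := surj g; congr (form_to_dual _); apply: (lker0_lfunK ker0).
- apply/vspaceP => g; apply/memv_imgP/mem_annihilatorP => [[v vI ->] w|gC].
    rewrite compB form_to_dualE => /mem_orthovP/(_ v vI) Bwv.
    by rewrite hermC Bwv mulr0.
  have [v Eg] := surj g; exists v => //; apply: contraT => vI.
  have [h hI hv] := linear_form_separates vI; have [w Eh] := surj h.
  case/eqP: hv; rewrite Eh form_to_dualE hermC -form_to_dualE -Eg gC ?mulr0 //.
  by rewrite compB; apply/mem_orthovP => u uI; rewrite -form_to_dualE -Eh hI.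
- apply/vspaceP => g; apply/memv_imgP/mem_annihilatorP => [[v vC ->] w wI|gI].
    by rewrite form_to_dualE; move: vC; rewrite compB => /mem_orthovP->.
  have [v Eg] := surj g; exists v => //; rewrite compB.
  by apply/mem_orthovP => w wI; rewrite -form_to_dualE -Eg gI.
Qed.

End DualOfForm.

(** * Compatible forms of the sextuple of an endomorphism *)

Section SextupleForms.
Variables (k : fieldType) (U : vectType k) (eta : 'End(U)).
Local Notation V := (U * U * U)%type.

(** An isomorphism with the dual is a nondegenerate bilinear form on [V] pairing
    each [I_i] to zero with [C_i], on both sides. The first two conditions leave
    only the (1,3), (2,2) and (3,1) components of this form, and the third
    expresses the other two through the middle one and makes [1 - eta] the
    adjoint of [eta] for it. *)
Lemma self_dual_gram n (e : n.-tuple U) (A : 'M[k]_n) :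
  basis_of {:U} e -> is_matrix_of e eta A -> self_dual (sextuple_of eta) ->
  exists2 G : 'M[k]_n, G \in unitmx & A^T *m G + G *m A = G.
Proof.
move=> e_basis eA [f [f_bij fI fC]].
pose F (v w : V) : k := (f v : 'Hom(V, k^o)) w.
have FDl u v w : F (u + v) w = F u w + F v w by rewrite /F linearD add_lfunE.
have FDr u v w : F u (v + w) = F u v + F u w by rewrite /F linearD.
have FNl u v : F (- u) v = - F u v by rewrite /F linearN opp_lfunE.
have FNr u v : F u (- v) = - F u v by rewrite /F linearN.
have FIC i v w : v \in sext_I (sextuple_of eta) i ->
    w \in sext_C (sextuple_of eta) i -> F v w = 0.
  move=> vI; have := memv_img f vI; rewrite fI => /mem_annihilatorP; exact.
have FCI i v w : v \in sext_C (sextuple_of eta) i ->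
    w \in sext_I (sextuple_of eta) i -> F v w = 0.
  move=> vC; have := memv_img f vC; rewrite fC => /mem_annihilatorP; exact.
pose o0 : 'I_3 := @Ordinal 3 0 isT; pose o1 : 'I_3 := @Ordinal 3 1 isT.
pose o2 : 'I_3 := @Ordinal 3 2 isT.
pose i1 (x : U) : V := (x, 0, 0); pose i2 (x : U) : V := (0, x, 0).
pose i3 (x : U) : V := (0, 0, x).
have F11 x a b : F (i1 x) (a, b, 0) = 0.
  by apply: (FIC o0); [apply/mem_I1; exists x | apply/mem_C1; exists a, b].
have F21 x a : F (i2 x) (i1 a) = 0.
  by apply: (FCI o0); [apply/mem_C1; exists 0, x | apply/mem_I1; exists a].
have F32 x a b : F (i3 x) (0, a, b) = 0.
  by apply: (FIC o1); [apply/mem_I2; exists x | apply/mem_C2; exists a, b].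
have F23 x a : F (i2 x) (i3 a) = 0.
  by apply: (FCI o1); [apply/mem_C2; exists x, 0 | apply/mem_I2; exists a].
have FE x1 x2 x3 y1 y2 y3 : F (x1, x2, x3) (y1, y2, y3) =
    F (i1 x1) (i3 y3) + F (i2 x2) (i2 y2) + F (i3 x3) (i1 y1).
  have -> : (x1, x2, x3) = i1 x1 + i2 x2 + i3 x3.
    by congr (_, _, _); rewrite /= ?addr0 ?add0r.
  rewrite !FDl; congr (_ + _ + _).
  - have -> : (y1, y2, y3) = (y1, y2, 0) + i3 y3.
      by congr (_, _, _); rewrite /= ?addr0 ?add0r.
    by rewrite FDr F11 add0r.
  - have -> : (y1, y2, y3) = i1 y1 + i2 y2 + i3 y3.
      by congr (_, _, _); rewrite /= ?addr0 ?add0r.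
    by rewrite !FDr F21 F23 addr0 add0r.
  - have -> : (y1, y2, y3) = i1 y1 + (0, y2, y3).
      by congr (_, _, _); rewrite /= ?addr0 ?add0r.
    by rewrite FDr F32 addr0.
have i1N x : i1 (- x) = - i1 x by congr (_, _, _); rewrite /= oppr0.
have i2N x : i2 (- x) = - i2 x by congr (_, _, _); rewrite /= oppr0.
have i3N x : i3 (- x) = - i3 x by congr (_, _, _); rewrite /= oppr0.
have F0r v : F v 0 = 0 by rewrite /F linear0.
have F0l v : F 0 v = 0 by rewrite /F linear0 lfunE.
pose b x y := F (i2 x) (i2 y).
have F31 x y : F (i3 x) (i1 y) = - b x y.
  have : F (- eta x, x, - x) (y, - y, 0) = 0.
    apply: (FIC o2); first by apply/mem_I3; exists x.
    apply/mem_C3; exists y, 0; rewrite linear0 oppr0.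
    by rewrite -[(y, _, _) in LHS]addr0.
  rewrite FE i2N i3N FNr FNl -[i3 0]/(0 : V) F0r add0r => /eqP.
  by rewrite -opprD oppr_eq0 addrC addr_eq0 => /eqP.
have F13 x y : F (i1 x) (i3 y) = - b x y.
  have : F (x, - x, 0) (- eta y, y, - y) = 0.
    apply: (FCI o2); last by apply/mem_I3; exists y.
    apply/mem_C3; exists x, 0; rewrite linear0 oppr0.
    by rewrite -[(x, _, _) in LHS]addr0.
  rewrite FE i2N i3N FNr FNl -[i3 0]/(0 : V) F0l addr0 => /eqP.
  by rewrite -opprD oppr_eq0 addr_eq0 => /eqP.
have bE x y : b (eta x) y + b x (eta y) = b x y.
  have : F (- eta x, x, - x) (- eta y, y, - y) = 0.
    apply: (FIC o2); first by apply/mem_I3; exists x.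
    apply/mem_C3; exists 0, y; rewrite oppr0.
    by rewrite -[(0, _, _)]/(0 : V) add0r.
  rewrite FE !i1N !i3N !FNl !FNr !opprK F31 F13 => /eqP.
  by rewrite addrAC -opprD addrC subr_eq0 => /eqP.
have b_suml (I : finType) (c : I -> k) (x : I -> U) y :
    b (\sum_i c i *: x i) y = \sum_i c i * b (x i) y.
  rewrite /b; have -> : i2 (\sum_i c i *: x i) = \sum_i c i *: i2 (x i).
    elim/big_rec2: _ => // i z t _ <-.
    by congr (_, _, _); rewrite /= ?scaler0 ?addr0.
  rewrite /F linear_sum sum_lfunE; apply: eq_bigr => i _.
  by rewrite linearZ scale_lfunE.
have b_sumr (I : finType) (c : I -> k) (y : I -> U) x :
    b x (\sum_i c i *: y i) = \sum_i c i * b x (y i).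
  rewrite /b; have -> : i2 (\sum_i c i *: y i) = \sum_i c i *: i2 (y i).
    elim/big_rec2: _ => // i z t _ <-.
    by congr (_, _, _); rewrite /= ?scaler0 ?addr0.
  by rewrite /F linear_sum; apply: eq_bigr => i _; rewrite linearZ.
exists (\matrix_(i, j) b e`_i e`_j).
  rewrite -row_free_unit -kermx_eq0; apply/rowV0P => r /sub_kermxP rG0.
  pose u := \sum_i r 0 i *: e`_i.
  have bu y : b u y = 0.
    rewrite [y](coord_basis e_basis (memvf y)) b_sumr big1 // => j _.
    have := congr1 (fun X : 'rV[k]_n => X 0 j) rG0; rewrite !mxE /u b_suml.
    by under eq_bigr => i _ do rewrite mxE; move=> ->; rewrite mulr0.
  have fu : f (i2 u) = f 0.
    apply/lfunP => -[[y1 y2] y3]; rewrite linear0 lfunE /=.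
    rewrite -/(F (i2 u) (y1, y2, y3)) FE -[i1 0]/(0 : V) -[i3 0]/(0 : V) !F0l.
    by rewrite -/(b u y2) bu !addr0.
  have u0 : u = 0 by case: (bij_inj f_bij fu).
  apply/rowP => i; rewrite mxE.
  by have /freeP/(_ (fun i => r 0 i) u0 i) := basis_free e_basis.
apply/matrixP => i j; rewrite !mxE -[RHS]bE !eA b_suml b_sumr.
congr (_ + _); apply: eq_bigr => a _; rewrite !mxE //.
exact: mulrC.
Qed.

Section FormOfGram.
Variables (n : nat) (x : n.-tuple U) (M : 'M[k]_n) (eps : bool).
Hypotheses (x_basis : basis_of {:U} x) (M_unit : M \in unitmx).
Hypothesis M_herm : M \is (eps, idfun : {rmorphism k -> k}).-sesqui.

Definition coord_row (u : U) : 'rV[k]_n := \row_i coord x i u.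

Lemma coord_row_linear : linear coord_row.
Proof. by move=> a u v; apply/rowP => i; rewrite !mxE linearP. Qed.

HB.instance Definition _ := GRing.isSemilinear.Build k U 'rV[k]_n _ coord_row
  (GRing.semilinear_linear coord_row_linear).

Definition base_form (u w : U) : k := form idfun M (coord_row u) (coord_row w).

Lemma coord_row_basis (i : 'I_n) : coord_row x`_i = delta_mx 0 i.
Proof.
apply/rowP => j; rewrite !mxE coord_free ?(basis_free x_basis) //= eq_sym.
by rewrite -val_eqE.
Qed.

Lemma base_form_basis (i j : 'I_n) : base_form x`_i x`_j = M i j.
Proof. by rewrite /base_form !coord_row_basis formee. Qed.

Lemma base_form0l u : base_form 0 u = 0.
Proof. by rewrite /base_form linear0 form0l. Qed.

Lemma base_form0r u : base_form u 0 = 0.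
Proof. by rewrite /base_form linear0 form0r. Qed.

Lemma base_formDl u v w : base_form (u + v) w = base_form u w + base_form v w.
Proof. by rewrite /base_form linearD formDl. Qed.

Lemma base_formDr u v w : base_form u (v + w) = base_form u v + base_form u w.
Proof. by rewrite /base_form linearD formDr. Qed.

Lemma base_formNl u w : base_form (- u) w = - base_form u w.
Proof. by rewrite /base_form linearN formNl. Qed.

Lemma base_formNr u w : base_form u (- w) = - base_form u w.
Proof. by rewrite /base_form linearN formNr. Qed.

Lemma base_formZl a u w : base_form (a *: u) w = a * base_form u w.
Proof. by rewrite /base_form linearZ formZl. Qed.

Lemma base_formZr a u w : base_form u (a *: w) = a * base_form u w.
Proof. by rewrite /base_form linearZ formZr. Qed.

Lemma base_formC u w : base_form u w = (-1) ^+ eps * base_form w u.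
Proof. exact: (formC (theta := idfun) _ M_herm). Qed.

Lemma base_form_nondeg u : (forall w, base_form u w = 0) -> u = 0.
Proof.
move=> u0; have : coord_row u *m M = 0.
  apply/rowP => j; have := u0 x`_j; rewrite /base_form coord_row_basis /form.
  by rewrite map_mx_id // trmx_delta -colE !mxE => ->.
move/(congr1 (mulmxr (invmx M))); rewrite /= mulmxK // mul0mx => cu0.
rewrite (coord_basis x_basis (memvf u)) big1 // => i _.
by have := congr1 (fun r : 'rV_n => r 0 i) cu0; rewrite !mxE => ->;
  rewrite scale0r.
Qed.

Definition triple_form (v w : V) : k :=
  base_form v.1.2 w.1.2 - base_form v.1.1 w.2 - base_form v.2 w.1.1.

Lemma triple_form_bilinear : bilinear_for
  (GRing.Scale.Law.clone _ _ ( *%R : k -> k -> k) _)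
  (GRing.Scale.Law.clone _ _ (idfun \; *%R : k -> k -> k) _) triple_form.
Proof.
split=> [w|v] a u t; rewrite /triple_form /= ?base_formDl ?base_formDr
  ?base_formZl ?base_formZr; ring.
Qed.

HB.instance Definition _ := bilinear_isBilinear.Build k V V k
  (GRing.Scale.Law.clone _ _ ( *%R : k -> k -> k) _)
  (GRing.Scale.Law.clone _ _ (idfun \; *%R : k -> k -> k) _)
  triple_form triple_form_bilinear.

Lemma triple_form_herm v w :
  triple_form v w = (-1) ^+ eps * idfun (triple_form w v).
Proof.
rewrite /triple_form [base_form v.1.2 _]base_formC [base_form v.1.1 _]base_formC.
by rewrite [base_form v.2 _]base_formC /=; ring.
Qed.

HB.instance Definition _ := isHermitianSesquilinear.Build k V eps idfun
  triple_form triple_form_herm.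

Let B : {hermitian V for eps & idfun} := triple_form.

Lemma gram_frame : is_gram_matrix B (frame x) (H_mx M).
Proof.
have f1 (i : 'I_n) : (frame x)`_(lshift (n + n) i) = (x`_i, 0, 0).
  by rewrite /= nth_cat size_map size_tuple ltn_ord (nth_map 0) ?size_tuple.
have f2 (i : 'I_n) : (frame x)`_(rshift n (lshift n i)) = (0, x`_i, 0).
  rewrite /= nth_cat size_map size_tuple ltnNge leq_addr /= addKn.
  by rewrite nth_cat size_map size_tuple ltn_ord (nth_map 0) ?size_tuple.
have f3 (i : 'I_n) : (frame x)`_(rshift n (rshift n i)) = (0, 0, x`_i).
  rewrite /= nth_cat size_map size_tuple ltnNge leq_addr /= addKn.
  rewrite nth_cat size_map size_tuple ltnNge leq_addr /= addKn.
  by rewrite (nth_map 0) ?size_tuple.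
move=> i j; rewrite /B /= /triple_form /H_mx.
case: (split_ordP i) => {}i ->; last (case: (split_ordP i) => {}i ->);
  (case: (split_ordP j) => {}j ->; last (case: (split_ordP j) => {}j ->));
  rewrite ?f1 ?f2 ?f3 /= ?base_form0l ?base_form0r ?base_form_basis
    ?(block_mxEul, block_mxEur, block_mxEdl, block_mxEdr)
    ?row_mxEl ?row_mxEr ?col_mxEu ?col_mxEd;
  by rewrite ?mxE ?subr0 ?sub0r ?subrr ?oppr0.
Qed.

Variable A : 'M[k]_n.
Hypotheses (eta_A : is_matrix_of x eta A) (A_adj : A^T *m M + M *m A = M).

Lemma base_form_adjoint u w :
  base_form (eta u) w + base_form u (eta w) = base_form u w.
Proof.
have row_eta t : coord_row (eta t) = coord_row t *m A^T.
  rewrite [t in LHS](coord_basis x_basis (memvf t)) !linear_sum /=.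
  rewrite mulmx_sum_row; apply: eq_bigr => i _; rewrite !linearZ /= mxE.
  congr (_ *: _); rewrite eta_A; apply/rowP => j; rewrite !mxE linear_sum /=.
  rewrite (bigD1 j) //= linearZ /= coord_free ?(basis_free x_basis) // eqxx.
  rewrite mulr1 big1 ?addr0 // => a ne_aj.
  by rewrite linearZ /= coord_free ?(basis_free x_basis) // (negPf ne_aj) mulr0.
rewrite /base_form !row_eta /form !map_mx_id // trmx_mul trmxK.
rewrite -[in RHS]A_adj mulmxDr mulmxDl [RHS]mxE.
by congr (_ + _); rewrite !mulmxA.
Qed.

(** Orthogonality to [I_1] or [I_2] kills one coordinate. Orthogonality of
    [(a, b, c)] to [I_3] reads [a + b + c = eta c] by the adjunction, and this
    equation defines [C_3]. *)
Lemma triple_form_compatible : compatible_form (sextuple_of eta) B.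
Proof.
have Bv v w : B v w = triple_form v w by [].
split=> [|i].
  rewrite /nondegenerate -subv0; apply/subvP => -[[a b] c] /mem_orthovP Bv0.
  have a0 : a = 0.
    apply: base_form_nondeg => w; have := Bv0 (0, 0, w) (memvf _).
    rewrite Bv /triple_form /= !base_form0r subr0 sub0r => /eqP.
    by rewrite oppr_eq0 => /eqP.
  have b0 : b = 0.
    apply: base_form_nondeg => w; have := Bv0 (0, w, 0) (memvf _).
    by rewrite Bv /triple_form /= !base_form0r !subr0.
  have c0 : c = 0.
    apply: base_form_nondeg => w; have := Bv0 (w, 0, 0) (memvf _).
    rewrite Bv /triple_form /= !base_form0r subr0 sub0r => /eqP.
    by rewrite oppr_eq0 => /eqP.
  by rewrite a0 b0 c0 mem0v.
apply/vspaceP => -[[a b] c]; apply/idP/mem_orthovP; case: i => [[|[|[|//]]] lt_i3].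
- rewrite (bool_irrelevance lt_i3 isT) => /mem_C1[y [z [-> -> ->]]].
  move=> _ /mem_I1[t ->]; rewrite Bv /triple_form /= !base_form0r base_form0l.
  by rewrite !subr0.
- rewrite (bool_irrelevance lt_i3 isT) => /mem_C2[y [z [-> -> ->]]].
  move=> _ /mem_I2[t ->]; rewrite Bv /triple_form /= !base_form0r base_form0l.
  by rewrite !subr0.
- rewrite (bool_irrelevance lt_i3 isT) => /mem_C3[y [z [-> -> ->]]].
  move=> _ /mem_I3[t ->]; rewrite Bv /triple_form /= add0r.
  rewrite !base_formDl ?(base_formNl, base_formNr) -(base_form_adjoint z t).
  by ring.
- rewrite (bool_irrelevance lt_i3 isT) => B0; apply/mem_C1; exists a, b.
  congr (_, _, _); apply: base_form_nondeg => w.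
  have := B0 (w, 0, 0) (introT (mem_I1 _ _) (ex_intro _ w erefl)).
  rewrite Bv /triple_form /= !base_form0r subr0 sub0r => /eqP.
  by rewrite oppr_eq0 => /eqP.
- rewrite (bool_irrelevance lt_i3 isT) => B0; apply/mem_C2; exists b, c.
  congr (_, _, _); apply: base_form_nondeg => w.
  have := B0 (0, 0, w) (introT (mem_I2 _ _) (ex_intro _ w erefl)).
  rewrite Bv /triple_form /= !base_form0r subr0 sub0r => /eqP.
  by rewrite oppr_eq0 => /eqP.
rewrite (bool_irrelevance lt_i3 isT) => B0.
have E : a + b + c - eta c = 0.
  apply: base_form_nondeg => w.
  rewrite -[RHS](B0 (- eta w, w, - w) (introT (mem_I3 _ _) (ex_intro _ w erefl))).
  rewrite Bv /triple_form /= !base_formDl ?(base_formNl, base_formNr).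
  by rewrite -(base_form_adjoint c w); ring.
apply/mem_C3; exists (a - eta c), (- c); rewrite linearN !opprK.
have /eqP : b + (a + c - eta c) = 0 by rewrite -[RHS]E !addrA [b + a]addrC.
rewrite addr_eq0 => /eqP Eb.
congr (_, _, _); rewrite /= ?add0r ?subrK //.
by rewrite Eb -opprD addrAC.
Qed.

End FormOfGram.

(** The converse of [self_dual_gram], with the symmetry kept: a form on [U] for
    which [1 - eta] is the adjoint of [eta] extends to [U * U * U] by the
    antidiagonal pattern of [H_mx]. *)
Lemma gram_compatible_form n (x : n.-tuple U) (A M : 'M[k]_n) eps :
  basis_of {:U} x -> is_matrix_of x eta A -> M \in unitmx ->
  M \is hermitianmx n eps idfun -> A^T *m M + M *m A = M ->
  exists B : {hermitian V for eps & idfun},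
    compatible_form (sextuple_of eta) B /\ is_gram_matrix B (frame x) (H_mx M).
Proof.
move=> x_basis eta_A uM hM A_adj.
have M_herm : M \is (eps, idfun : {rmorphism k -> k}).-sesqui by [].
eexists; split; last exact: (gram_frame x_basis M_herm).
exact: (triple_form_compatible x_basis uM M_herm eta_A A_adj).
Qed.

End SextupleForms.

(** * Transfer to matrices *)

Section Intertwining.
Variable k : fieldType.

Lemma horner_mx_intertwine n l (A : 'M[k]_n.+1) (B : 'M[k]_l.+1)
    (E : 'M[k]_(l.+1, n.+1)) f :
  E *m A = B *m E -> E *m horner_mx A f = horner_mx B f *m E.
Proof.
move=> EA; elim/poly_ind: f => [|f c IHf].
  by rewrite !rmorph0 mulmx0 mul0mx.
rewrite !rmorphD !rmorphM /= !horner_mx_C !horner_mx_X mulmxDr mulmxDl.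
rewrite -scalar_mxC; congr (_ + _).
by rewrite -!mulmxE mulmxA IHf -!mulmxA EA.
Qed.

Lemma horner_mx_tr n (A : 'M[k]_n.+1) f : horner_mx A^T f = (horner_mx A f)^T.
Proof.
elim/poly_ind: f => [|f c IHf]; first by rewrite !rmorph0 linear0.
rewrite !rmorphD !rmorphM /= !horner_mx_C !horner_mx_X linearD /=.
rewrite tr_scalar_mx IHf -!mulmxE -trmx_mul; congr (_^T + _).
by rewrite -(comm_mx_horner f (erefl (A *m A))).
Qed.

Lemma horner_mx_comp n (A : 'M[k]_n.+1) f g :
  horner_mx A (f \Po g) = horner_mx (horner_mx A g) f.
Proof.
elim/poly_ind: f => [|f c IHf]; first by rewrite comp_poly0 !rmorph0.
rewrite comp_poly_MXaddC !rmorphD !rmorphM /= !horner_mx_C horner_mx_X.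
by rewrite IHf.
Qed.

Lemma kermxpoly_shift n (A : 'M[k]_n) c f :
  kermxpoly (A - c%:M) (f \Po ('X + c%:P)) = kermxpoly A f.
Proof.
case: n A => [|n] A; first by rewrite !thinmx0.
rewrite /kermxpoly horner_mx_comp rmorphD /= horner_mx_X horner_mx_C.
by rewrite subrK.
Qed.

Lemma kermxpoly_full_dvd n (A : 'M[k]_n) f g :
  f %| g -> row_full (kermxpoly A f) -> row_full (kermxpoly A g).
Proof.
case: n A => [|n] A; first by rewrite !thinmx0 => _ _; rewrite -col_leq_rank.
case/dvdpP=> h ->; rewrite -!sub1mx => /sub_kermxP; rewrite mul1mx => fA.
by apply/sub_kermxP; rewrite rmorphM /= fA mulr0 mulmx0.
Qed.

Lemma char_poly_tr n (A : 'M[k]_n) : char_poly A^T = char_poly A.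
Proof.
rewrite /char_poly -det_tr; congr (\det _); apply/matrixP => i j.
by rewrite !mxE eq_sym.
Qed.

(** The matrix of [A] on an invariant subspace, if it is the Frobenius matrix of
    [p], is annihilated by [q^m] and, [A] being conjugate to [-A^T], by
    [q(-x)^m]. By degrees [p] is associate to both [q] and [q(-x)], hence to
    [p(-x)]; the factor is [1] because the constant coefficient of [p], up to
    sign the determinant of a restriction of the invertible [A], is nonzero. *)
Lemma frobenius_even n l m (A G : 'M[k]_n) (E : 'M[k]_(l, n)) (p q : {poly k}) :
  (2%:R : k) != 0 -> (0 < n)%N -> (0 < l)%N ->
  irreducible_poly q -> size q = l.+1 -> p \is monic -> size p = l.+1 ->
  row_full (kermxpoly A (q ^+ m)) ->
  row_free E -> E *m A = (frobenius_mx l p)^T *m E ->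
  A \in unitmx -> G \in unitmx -> A *m G = - (G *m A^T) ->
  [/\ irreducible_poly p, p \Po - 'X = p & (1 < l)%N].
Proof.
move=> k2; case: n A G E => // n A G E _; case: l E => // l E _.
move=> q_irr size_q p_monic size_p qA freeE EA uA uG AG.
set Z := frobenius_mx l.+1 p in EA.
have eq_p (f : {poly k}) : irreducible_poly f -> size f = l.+2 ->
    horner_mx A (f ^+ m) = 0 -> f %= p.
  move=> f_irr size_f fA.
  have : horner_mx Z^T (f ^+ m) = 0.
    by apply: (row_free_inj freeE); rewrite -(horner_mx_intertwine _ EA) fA
      mulmx0 mul0mx.
  move/mxminpoly_min => min_f.
  have fmin : f %| mxminpoly Z^T.
    apply: contraLR (mxminpoly_nonconstant Z^T).
    move=> /(irreducible_coprime f_irr)/(coprimep_expl m) cop.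
    rewrite -leqNgt -ltnS -size_mxminpoly -(eqp_size (dvdp_gcd_idl min_f)).
    by move: cop; rewrite coprimep_sym coprimep_def => /eqP->.
  have fp : f %| p.
    apply: dvdp_trans fmin _.
    rewrite -[X in _ %| X](char_poly_frobenius p_monic size_p) -char_poly_tr.
    exact: mxminpoly_dvd_char.
  by rewrite -dvdp_size_eqp // size_f size_p.
have q_p : q %= p by apply: eq_p => //; move: qA; rewrite -sub1mx =>
  /sub_kermxP; rewrite mul1mx.
have qN_p : q \Po - 'X %= p.
  have NK : - 'X \Po - 'X = 'X :> {poly k}.
    by rewrite -[X in X \Po _]scaleN1r comp_polyZ comp_polyX scaleN1r opprK.
  have sz_NX : size (- 'X : {poly k}) = 2 by rewrite size_polyN size_polyX.
  apply: eq_p; first exact: (irreducible_comp_linear q_irr sz_NX NK NK).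
    by rewrite size_comp_poly2.
  apply: trmx_inj; rewrite -horner_mx_tr trmx0.
  rewrite -rmorphXn /= horner_mx_comp rmorphN /= horner_mx_X.
  have GA : G *m - A^T = A *m G by rewrite AG mulmxN.
  move: qA; rewrite -sub1mx => /sub_kermxP; rewrite mul1mx => qA.
  apply: (can_inj (mulKmx uG)); rewrite mulmx0.
  by rewrite (horner_mx_intertwine _ GA) qA mul0mx.
have p_irr : irreducible_poly p by apply: eqp_irreducible q_irr.
have pN_p : p \Po - 'X %= p.
  apply: eqp_trans qN_p; rewrite eqp_sym; case/andP: q_p => qp pq.
  by apply/andP; split; apply: dvdp_comp_poly.
have p0 : p`_0 != 0.
  rewrite -(char_poly_frobenius p_monic size_p) char_poly_det.
  rewrite mulf_neq0 ?signr_eq0 // -det_tr -unitfE -unitmxE -row_free_unit.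
  rewrite -kermx_eq0; apply/rowV0P => r /sub_kermxP rZ.
  apply: (row_free_inj freeE); apply: (can_inj (mulmxK uA)).
  by rewrite -mulmxA EA mulmxA rZ !mul0mx.
have p_even : p \Po - 'X = p.
  have /eqpP[[a b] /= /andP[a0 b0] E0] := pN_p.
  have := congr1 (fun f : {poly k} => f`_0) E0.
  rewrite !coefZ coef_comp_polyN expr0 mul1r => /(mulIf p0) Eab.
  by apply: (scalerI b0); rewrite -E0 Eab.
split=> //; have := even_poly_degree p_monic size_p p_even k2.
by case: l {EA freeE size_p size_q Z eq_p E}.
Qed.

End Intertwining.

(** * The endomorphism and its matrices *)

Section Endomorphism.
Variables (k : fieldType) (U : vectType k) (eta : 'End(U)).
Local Notation e := (vbasis {:U}).
Local Notation A := (mxof e e eta).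
Let e_basis : basis_of {:U} e := vbasisP {:U}.

Lemma vbasis_matrix : is_matrix_of e eta A^T.
Proof.
move=> j; rewrite -vecof_delta (hom_vecof _ e_basis).
by apply: eq_bigr => i _; rewrite -rowE !mxE.
Qed.

Lemma indecomposable_mxof : indecomposable_endo eta -> indec_mx A.
Proof.
case=> U0 indU; split; first by rewrite lt0n dimv_eq0; apply/eqP.
have stable (W : 'M_(\dim {:U})) :
    stablemx W A -> (eta @: vsof e W <= vsof e W)%VS.
  move=> sW; apply/subvP => _ /memv_imgP[u uW ->].
  rewrite -rVof_sub // (rVof_app _ e_basis) //; apply: submx_trans sW.
  by rewrite submxMr // rVof_sub.
move=> W1 W2 /stable s1 /stable s2 full cap0.
have [||/eqP|/eqP] := indU _ _ s1 s2; rewrite ?vsof_eq0 //; last 2 first.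
- by move/eqP; left.
- by move/eqP; right.
- apply/eqP; rewrite eqEsubv subvf /=; apply/subvP => u _.
  have : (rVof e u <= W1 + W2)%MS by rewrite submx_full.
  case/sub_addsmxP=> [[D1 D2] /= Eu]; apply/memv_addP.
  exists (vecof e (D1 *m W1)); first by rewrite -rVof_sub // vecofK // submxMl.
  exists (vecof e (D2 *m W2)); first by rewrite -rVof_sub // vecofK // submxMl.
  by rewrite -linearD /= -Eu rVofK.
apply/eqP; rewrite -subv0; apply/subvP => u; rewrite memv_cap -!rVof_sub //.
by rewrite -sub_capmx cap0 submx0 rVof_eq0 // memv0.
Qed.

Lemma no_eigenvalue_unit a : ~~ leigenvalue eta a -> A - a%:M \in unitmx.
Proof.
rewrite /leigenvalue (leigenspaceE e_basis) vsof_eq0 // negbK => /eqP ker0.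
by rewrite -row_free_unit -kermx_eq0 -ker0.
Qed.

Lemma matrix_rows n (x : n.-tuple U) (J : 'M[k]_n) :
  is_matrix_of x eta J <->
  (\matrix_(i < n) rVof e x`_i) *m A = J^T *m \matrix_(i < n) rVof e x`_i.
Proof.
set X := \matrix_(i < n) rVof e x`_i.
have row_X j : row j (J^T *m X) = rVof e (\sum_(i < n) J i j *: x`_i).
  rewrite row_mul linear_sum mulmx_sum_row; apply: eq_bigr => i _.
  by rewrite !mxE linearZ /= rowK.
split=> [xJ|XA j].
  by apply/row_matrixP => j; rewrite row_X -xJ row_mul rowK (rVof_app _ e_basis).
apply: (can_inj (rVofK e_basis)).
by rewrite -row_X -XA row_mul rowK (rVof_app _ e_basis).
Qed.

Lemma dim_char_poly (q : {poly k}) m l :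
  size q = l.+1 -> char_poly_lfun eta = q ^+ m -> \dim {:U} = (\sum_(i < m) l)%N.
Proof.
move=> size_q char_eta; rewrite sum_nat_const card_ord mulnC.
by rewrite -[l]/(l.+1.-1) -size_q -size_exp -char_eta size_char_poly.
Qed.

Lemma row_full_basis n (P : 'M[k]_(n, \dim {:U})) :
  n = \dim {:U} -> row_full P ->
  exists2 x : n.-tuple U, basis_of {:U} x & \matrix_(i < n) rVof e x`_i = P.
Proof.
move=> En fullP; exists [tuple vecof e (row i P) | i < n]; last first.
  by apply/row_matrixP => i; rewrite rowK -tnth_nth tnth_mktuple vecofK.
rewrite basisEdim size_tuple; apply/andP; split; last by rewrite En.
apply/subvP => u _.
have /submxP[D Eu] : (rVof e u <= P)%MS by rewrite submx_full.
rewrite -[u](rVofK e_basis) Eu mulmx_sum_row linear_sum memv_suml // => i _.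
rewrite linearZ memvZ // memv_span //; apply/tnthP.
by exists i; rewrite tnth_mktuple.
Qed.

Lemma basis_rows_free n (x : n.-tuple U) : basis_of {:U} x ->
  row_free (\matrix_(i < n) rVof e x`_i).
Proof.
move=> x_basis; rewrite -kermx_eq0; apply/rowV0P => r /sub_kermxP rX0.
apply/rowP => i; rewrite mxE.
have /freeP/(_ (fun i => r 0 i)) := basis_free x_basis; apply.
apply: (can_inj (rVofK e_basis)); rewrite linear0 -rX0 linear_sum mulmx_sum_row.
by apply: eq_bigr => j _; rewrite linearZ /= rowK.
Qed.

(** The first block of rows is the one that the shift kills. *)
Lemma jordan_first_block m l (X : 'M[k]_(\sum_(i < m) l, \dim {:U}))
    (B : 'M[k]_(\dim {:U})) (Z : 'M[k]_l) : (0 < m)%N ->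
  row_free X -> X *m B = (jordan_mx m Z)^T *m X ->
  exists2 E : 'M[k]_(l, \dim {:U}), row_free E & E *m B = Z^T *m E.
Proof.
case: m X => // m X _ freeX; rewrite -[X]submxcolK mxcol_mul jordan_mx_split.
rewrite linearD /= tr_mxdiag mulmxDl mul_mxdiag_mxcol tr_mxblock.
rewrite mul_mxblock_mxrow -mxcolD => /eq_mxcolP/(_ ord0) E0.
exists (submxcol X ord0); last first.
  rewrite E0 big1 ?addr0 // => i _.
  by rewrite trmx0 mul0mx.
rewrite -kermx_eq0; apply/rowV0P => r /sub_kermxP.
have -> : submxcol X ord0 = submxcol 1%:M ord0 *m X.
  by rewrite mul_rowsub_mx mul1mx.
rewrite mulmxA -[RHS](mul0mx _ X) => /(row_free_inj freeX) r0.
apply/rowP => j; rewrite mxE.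
have := congr1 (fun M : 'rV_(\sum_(i < m.+1) l) => M 0 (tagnat.Rank ord0 j)) r0.
rewrite !mxE (bigD1 j) //= !mxE eqxx mulr1 big1 ?addr0 // => i ne_ij.
by rewrite !mxE -val_eqE tagnat.eq_Rank eqxx /= val_eqE (negPf ne_ij) mulr0.
Qed.

End Endomorphism.

(** * Self-dual sextuples of indecomposable endomorphisms *)

Section SelfDualSextuples.
Variables (k : fieldType) (U : vectType k) (eta : 'End(U)).
Hypotheses (k_char : 2%N \notin [pchar k]).
Hypothesis eta_indec : indecomposable_endo eta.
Hypothesis eta_no_eigenvalue : forall a : k, ~~ leigenvalue eta a.
Local Notation e := (vbasis {:U}).
Local Notation A := (mxof e e eta).
Local Notation half := (2%:R^-1 : k).
Local Notation zeta := (A - half%:M).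

Lemma two_neq0 : (2%:R : k) != 0.
Proof. by apply: contra k_char => two0; rewrite inE /= two0. Qed.

Lemma halfD : half + half = 1.
Proof. by rewrite -mulr2n -(mulr_natl half) mulfV ?two_neq0. Qed.

(** Subtracting [1/2] turns the relation between [eta] and [1 - eta] into
    skew-adjointness. *)
Lemma self_dual_gram_skew : self_dual (sextuple_of eta) ->
  exists2 G : 'M[k]_(\dim {:U}), G \in unitmx & zeta *m G = - (G *m zeta^T).
Proof.
move/(self_dual_gram (vbasisP _) (vbasis_matrix eta)) => [G uG].
rewrite trmxK => AG; exists G => //; apply/eqP; rewrite -addr_eq0.
rewrite linearB /= tr_scalar_mx mulmxBl mulmxBr addrACA AG.
rewrite mul_scalar_mx mul_mx_scalar -opprD -scalerDl.
by rewrite halfD scale1r subrr.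
Qed.

Lemma self_dual_forms (eps : bool) : self_dual (sextuple_of eta) ->
  admits_compatible_form (sextuple_of eta) eps.
Proof.
case/self_dual_gram_skew=> G uG zG.
have [H [uH zH Ht]] := symmetrize_skew_adjoint eps two_neq0
  (indec_mx_shift _ (indecomposable_mxof eta_indec))
  (no_eigenvalue_unit (eta_no_eigenvalue _)) uG zG.
have [||B [compB _]] := gram_compatible_form (eps := eps) (M := H)
  (vbasisP _) (vbasis_matrix eta) uH; last by exists B.
  by apply/hermitianmx_idP.
rewrite trmxK -[A](subrK half%:M) linearD /= tr_scalar_mx mulmxDl mulmxDr.
rewrite addrACA zH addNr add0r mul_scalar_mx mul_mx_scalar -scalerDl.
by rewrite halfD scale1r.
Qed.

Lemma self_dual_iff_form (eps : bool) : self_dual (sextuple_of eta) <->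
  admits_compatible_form (sextuple_of eta) eps.
Proof.
by split=> [/self_dual_forms//|[B /compatible_form_self_dual]].
Qed.

Variables (q : {poly k}) (m l : nat).
Hypotheses (q_irr : irreducible_poly q) (size_q : size q = l.+1).
Hypothesis char_eta : char_poly_lfun eta = q ^+ m.

Lemma dim_gt0 : (0 < \dim {:U})%N.
Proof. by case: (indecomposable_mxof eta_indec). Qed.

Lemma multiplicity_gt0 : (0 < m)%N.
Proof.
have := dim_gt0; rewrite (dim_char_poly size_q char_eta) sum_nat_const card_ord.
by rewrite muln_gt0 => /andP[].
Qed.

Lemma degree_gt0 : (0 < l)%N.
Proof. by have [] := q_irr; rewrite size_q. Qed.

(** The monic irreducible polynomial of [eta - 1/2], obtained from [q] by
    translation and normalization. *)
Lemma shifted_primary : exists q1 : {poly k}, [/\ irreducible_poly q1,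
  q1 \is monic, size q1 = l.+1 & row_full (kermxpoly zeta (q1 ^+ m))].
Proof.
pose q2 := q \Po ('X + half%:P).
have XK : ('X + half%:P) \Po ('X - half%:P) = 'X.
  by rewrite comp_polyD comp_polyX comp_polyC subrK.
have XK' : ('X - half%:P) \Po ('X + half%:P) = 'X.
  by rewrite comp_polyB comp_polyX comp_polyC addrK.
have q2_irr : irreducible_poly q2.
  by apply: irreducible_comp_linear XK XK' => //; rewrite size_XaddC.
have size_q2 : size q2 = l.+1 by rewrite size_comp_poly2 ?size_XaddC.
have lead_q2 : lead_coef q2 != 0 by rewrite lead_coef_eq0 irredp_neq0.
pose q1 := (lead_coef q2)^-1 *: q2.
have q2_q1 : q2 %= q1 by rewrite eqp_sym eqp_scale ?invr_neq0.
exists q1; split; first exact: eqp_irreducible q2_q1 q2_irr.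
- by rewrite monicE lead_coefZ mulVf.
- by rewrite -(eqp_size q2_q1).
have q2A : row_full (kermxpoly zeta (q2 ^+ m)).
  by rewrite -rmorphXn /= kermxpoly_shift -char_eta kermxpoly_char_poly.
by apply: kermxpoly_full_dvd q2A; rewrite dvdp_exp2r // (eqp_dvdl _ q2_q1).
Qed.

Lemma suitable_basis_exists : perfect_field k ->
  exists x Z, @suitable_basis k U eta m l x Z.
Proof.
move=> k_perfect; have [q1 [q1_irr q1_monic size_q1 q1A]] := shifted_primary.
have [v cyc] := indec_cyclic (indec_mx_shift half (indecomposable_mxof eta_indec))
  q1_irr q1A.
have [P [fullP PA]] := jordan_rows multiplicity_gt0 degree_gt0 dim_gt0 q1_monic
  size_q1 (k_perfect _ q1_irr) q1A cyc.
have [x x_basis xP] := row_full_basis (esym (dim_char_poly size_q char_eta)) fullP.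
exists x, (frobenius_mx l q1); split=> //; first by exists q1.
apply/matrix_rows; rewrite xP jordan_mx_shift linearD /= tr_scalar_mx.
by rewrite mulmxDl -PA mulmxBr mul_scalar_mx mul_mx_scalar addrC subrK.
Qed.

Lemma suitable_basis_polynomial (x : (\sum_(i < m) l).-tuple U) (Z : 'M[k]_l) :
  self_dual (sextuple_of eta) -> suitable_basis eta x Z ->
  exists p : {poly k}, [/\ p \is monic, size p = l.+1, Z = frobenius_mx l p &
    [/\ irreducible_poly p, p \Po - 'X = p & (1 < l)%N]].
Proof.
move=> /self_dual_gram_skew[G uG zG] [x_basis [p [p_monic size_p EZ]] xJ].
have [q1 [q1_irr q1_monic size_q1 q1A]] := shifted_primary.
exists p; split=> //; rewrite {Z}EZ in xJ.
move: xJ; rewrite matrix_rows jordan_mx_shift linearD /= tr_scalar_mx.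
set X := \matrix_i _; rewrite mulmxDl mul_scalar_mx => XA.
have Xz : X *m zeta = (jordan_mx m (frobenius_mx l p))^T *m X.
  by rewrite mulmxBr XA mul_mx_scalar addrC addKr.
have [E freeE EA] :=
  jordan_first_block multiplicity_gt0 (basis_rows_free x_basis) Xz.
exact: (frobenius_even two_neq0 dim_gt0 degree_gt0 q1_irr size_q1 p_monic size_p
  q1A freeE EA (no_eigenvalue_unit (eta_no_eigenvalue _)) uG zG).
Qed.

Lemma admissible_T_exists (x : (\sum_(i < m) l).-tuple U) (Z : 'M[k]_l) tau :
  self_dual (sextuple_of eta) -> suitable_basis eta x Z ->
  exists T, admissible_T Z tau T.
Proof.
move=> sd /(suitable_basis_polynomial sd).
case=> p [p_monic size_p -> [p_irr p_even l_gt1]].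
have [T [uT TZ Tt]] := frobenius_form_exists tau p_monic size_p p_irr p_even
  two_neq0 l_gt1.
exists T; split=> //; last exact/hermitianmx_idP.
by rewrite TZ mulNmx mulmxK.
Qed.

Lemma admissible_T_form (x : (\sum_(i < m) l).-tuple U) (Z T : 'M[k]_l)
    (eps : bool) :
  suitable_basis eta x Z -> admissible_T Z (odd m.+1 (+) eps) T ->
  exists B : {hermitian (U * U * U)%type for eps & idfun},
    compatible_form (sextuple_of eta) B /\
    is_gram_matrix B (frame x) (H_mx (M_mx m T)).
Proof.
move=> [x_basis _ xJ] [uT TZ hT].
have {}TZ : T *m Z = - (Z^T *m T).
  by rewrite -[LHS](mulmxKV uT) TZ mulNmx.
apply: (gram_compatible_form x_basis xJ (M_mx_unit m uT)).
  by rewrite M_mx_hermitian // multiplicity_gt0.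
rewrite jordan_mx_shift linearD /= tr_scalar_mx mulmxDl mulmxDr addrACA.
rewrite jordan_mx_skew // addNr addr0 mul_scalar_mx mul_mx_scalar -scalerDl.
by rewrite halfD scale1r.
Qed.

End SelfDualSextuples.

Theorem theorem8p9 (k : fieldType) (k_perfect : perfect_field k)
    (k_char : 2%N \notin [pchar k]) (U : vectType k) (eta : 'End(U))
    (eta_indec : indecomposable_endo eta)
    (eta_no_eigenvalue : forall a : k, ~~ leigenvalue eta a) :
  [/\ self_dual (sextuple_of eta) <->
        admits_compatible_form (sextuple_of eta) true,
      self_dual (sextuple_of eta) <->
        admits_compatible_form (sextuple_of eta) false
    & forall (q : {poly k}) (m l : nat),
        irreducible_poly q -> size q = l.+1 -> char_poly_lfun eta = q ^+ m ->
        (forall (T : 'M[k]_l) (eps : bool),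
           (H_mx (M_mx m T) \is hermitianmx _ eps idfun) =
             (M_mx m T \is hermitianmx _ eps idfun) /\
           (M_mx m T \is hermitianmx _ eps idfun) =
             (T \is hermitianmx _ (odd m.+1 (+) eps) idfun)) /\
        (self_dual (sextuple_of eta) ->
         (exists x Z, @suitable_basis k U eta m l x Z) /\
         forall x Z, @suitable_basis k U eta m l x Z ->
         forall eps : bool,
           (exists T, admissible_T Z (odd m.+1 (+) eps) T) /\
           (forall T, admissible_T Z (odd m.+1 (+) eps) T ->
            exists B : {hermitian (U * U * U)%type for eps & idfun},
              compatible_form (sextuple_of eta) B /\
              is_gram_matrix B (frame x) (H_mx (M_mx m T))))].
Proof.
split; [exact: self_dual_iff_form | exact: self_dual_iff_form |].
move=> q m l q_irr size_q char_eta; split.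
  move=> T eps; split; first exact: H_mx_hermitian.
  exact/M_mx_hermitian/(multiplicity_gt0 eta_indec size_q char_eta).
move=> sd; split.
  exact: (suitable_basis_exists eta_indec q_irr size_q char_eta k_perfect).
move=> x Z xZ eps; split.
  exact: (admissible_T_exists k_char eta_indec eta_no_eigenvalue q_irr size_q
    char_eta _ sd xZ).
move=> T; exact: (admissible_T_form k_char eta_indec size_q char_eta xZ).
Qed.
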